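(* Let $(M,g,\psi)$ be a nearly Kähler six-manifold, let $K$ be an abelian Lie group, let $\mathcal{P}\to M$ be a principal $K$-bundle, and let $A$ be an instanton on $\mathcal{P}$. Then $A$ is rigid, i.e. the only section $\epsilon\in\Gamma(\mathrm{Ad}_{\mathcal P}\otimes T^*M)$ satisfying $$\mathrm{d}^A\epsilon\cdot\psi=0,\qquad \mathrm{d}^A{\ast}\epsilon=0$$ is $\epsilon=0$.
   Context: Clifford multiplication satisfies $v\cdot v=-|v|^2$, and differential forms act on spinors through the vector space isomorphism $\Lambda^*V\cong \mathrm{Cl}(V,g)$ sending $e^{a_1}\wedge\dots\wedge e^{a_k}$ to $e^{a_1}\cdots e^{a_k}$ for an orthonormal basis $(e^a)$ and distinct indices. The real spinor bundle $SM$ of an oriented Riemannian spin six-manifold is the real rank-8 bundle of irreducible Clifford modules, with a fibre metric for which Clifford multiplication by vectors is skew-adjoint. A nearly Kähler six-manifold $(M,g,\psi)$ is an oriented six-dimensional Riemannian spin manifold with a unit-length section $\psi$ of $SM$ (a real Killing spinor) satisfying $\nabla^{LC}_X\psi=\tfrac12 X\cdot\psi$ for all vector fields $X$, where $\nabla^{LC}$ is the Levi-Civita connection (the constant $\tfrac12$ is a normalisation of the metric). $\mathrm{Ad}_{\mathcal P}$ denotes the adjoint bundle. A connection $A$ on $\mathcal P$ with curvature $F\in\Gamma(\Lambda^2M\otimes \mathrm{Ad}_{\mathcal P})$ is an instanton if $F\cdot\psi=0$ in $\Gamma(SM\otimes\mathrm{Ad}_{\mathcal P})$, where the two-form part of $F$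 acts on $\psi$ by Clifford multiplication. The space of (infinitesimal) deformations of an instanton $A$ is the space of $\epsilon\in\Gamma(\mathrm{Ad}_{\mathcal P}\otimes T^*M)$ with $\mathrm{d}^A\epsilon\cdot\psi=0$ (linearised instanton equation) and $\mathrm{d}^A{\ast}\epsilon=0$ (gauge-fixing); the instanton is rigid if this space is zero.
   Formalization: The manifold M is assumed compact; without this the claim fails, e.g. on an open ball in the round six-sphere with K = U(1), A trivial and ε = df for a non-constant harmonic function f. *)

(* Defs.v *)
(* Tangent vectors in a chart are row vectors; geometric objects              *)
(* are families of local components, indexed by charts and by local           *)
(* trivialisations, related by the transformation laws.  The components are   *)
(* total functions of the point of the manifold, but carry information only   *)
(* on the domain of the chart (and of the trivialisation).                    *)
From mathcomp Require Import all_boot all_order all_algebra.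
From mathcomp Require Import all_classical all_reals all_analysis.

Set Implicit Arguments.
Unset Strict Implicit.
Unset Printing Implicit Defensive.

Import Order.TTheory GRing.Theory Num.Theory.
Import numFieldNormedType.Exports.

Local Open Scope classical_set_scope.
Local Open Scope ring_scope.

Section smoothness.
Variable R : realType.

Fixpoint Ck_on (k : nat) (V W : normedModType R) (U : set V) (f : V -> W) : Prop :=
  if k is l.+1 then
    (forall x, U x -> differentiable f x) /\
    (forall v, Ck_on l U (fun x => 'D_v f x : W))
  else forall x, U x -> {for x, continuous f}.

(* Meant for open U. *)
Definition smooth_on (V W : normedModType R) (U : set V) (f : V -> W) : Prop :=
  forall k, Ck_on k U f.

End smoothness.

(* A smooth atlas of dimension n; par i is the inverse of coord i : dom i -> R^n. *)
Record manifold (R : realType) (n : nat) := Manifold {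
  man_sort :> topologicalType;
  man_hausdorff : hausdorff_space man_sort;
  man_second_countable : @second_countable man_sort;
  chart : Type;
  dom : chart -> set man_sort;
  coord : chart -> man_sort -> 'rV[R]_n;
  par : chart -> 'rV[R]_n -> man_sort;
  dom_open : forall i, open (dom i);
  dom_cover : forall x, exists i, dom i x;
  coord_open : forall i, open (coord i @` dom i);
  coordK : forall i x, dom i x -> par i (coord i x) = x;
  coord_continuous : forall i x, dom i x -> {for x, continuous (coord i)};
  par_continuous : forall i x, dom i x -> {for coord i x, continuous (par i)};
  transition_smooth : forall i j,
    smooth_on (coord i @` (dom i `&` dom j)) (coord j \o par i) }.

Section calculus_on_manifolds.
Variables (R : realType) (n : nat) (M : manifold R n).

(* Jacobian of the change from chart i to chart j: v in chart i is            *)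
(* v *m trans i j x in chart j.                                               *)
Definition trans (i j : chart M) (x : M) : 'M[R]_n :=
  'J (coord j \o par i) (coord i x).

Definition oriented_atlas : Prop :=
  forall (i j : chart M) x, dom i x -> dom j x -> 0 < \det (trans i j x).

(* Smoothness of a vector-valued function on an open subset U of M. *)
Definition smooth_fun (W : normedModType R) (U : set M) (f : M -> W) : Prop :=
  forall i : chart M, smooth_on (coord i @` (dom i `&` U)) (f \o par i).

(* Derivative of f at x along the tangent vector with components v in chart i. *)
Definition pd (W : normedModType R) (i : chart M) (v : 'rV[R]_n) (f : M -> W)
  (x : M) : W := 'D_v (f \o par i) (coord i x).

Definition smooth_map (m : nat) (N : manifold R m) (U : set M) (f : M -> N) : Prop :=
  (forall x, U x -> {for x, continuous f}) /\
  forall (i : chart M) (j : chart N),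
    smooth_on (coord i @` (dom i `&` U `&` f @^-1` dom j))
              (coord j \o f \o par i).

End calculus_on_manifolds.

(* lg_chart1 is a chosen chart around the identity: it identifies the Lie     *)
(* algebra T_1 K with 'rV_m.                                                  *)
Record lie_group (R : realType) (m : nat) := LieGroup {
  lg_man :> manifold R m;
  lg_one : lg_man;
  lg_mul : lg_man -> lg_man -> lg_man;
  lg_inv : lg_man -> lg_man;
  lg_mulA : associative lg_mul;
  lg_mul1 : left_id lg_one lg_mul;
  lg_mulV : left_inverse lg_one lg_inv lg_mul;
  lg_mul_continuous : continuous (fun p : lg_man * lg_man => lg_mul p.1 p.2);
  lg_mul_smooth : forall i j l : chart lg_man,
    smooth_on
      [set p : 'rV[R]_m * 'rV[R]_m | exists x y,
         [/\ dom i x, dom j y, dom l (lg_mul x y) & p = (coord i x, coord j y)]]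
      (fun p => coord l (lg_mul (par i p.1) (par j p.2)));
  lg_inv_smooth : smooth_map setT lg_inv;
  lg_chart1 : chart lg_man;
  lg_chart1P : dom lg_chart1 lg_one }.

Definition lg_abelian (R : realType) (m : nat) (K : lie_group R m) : Prop :=
  commutative (@lg_mul R m K).

Section lie_algebra.
Variables (R : realType) (m : nat) (K : lie_group R m).
Notation c1 := (coord (lg_chart1 K)).
Notation p1 := (par (lg_chart1 K)).
Notation o1 := (c1 (lg_one K)).

(* X *m Ad k is the adjoint action of k on X. *)
Definition Ad (k : K) : 'M[R]_m :=
  'J (fun u => c1 (lg_mul (lg_mul k (p1 u)) (lg_inv k))) o1.

(* [X, Y] = ad X Y, where ad is the differential of Ad at the identity. *)
Definition lie_bracket (X Y : 'rV[R]_m) : 'rV[R]_m :=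
  'D_X (fun u => Y *m Ad (p1 u)) o1.

(* (t^* theta)(v) at x, where theta is the left Maurer-Cartan form of K. *)
Definition maurer_cartan (n : nat) (M : manifold R n) (i : chart M) (t : M -> K)
  (v : 'rV[R]_n) (x : M) : 'rV[R]_m :=
  pd i v (fun y => c1 (lg_mul (lg_inv (t x)) (t y))) x.

End lie_algebra.

Record metric (R : realType) (n : nat) (M : manifold R n) := Metric {
  met :> chart M -> M -> 'M[R]_n;
  met_smooth : forall i, smooth_fun (dom i) (met i);
  met_sym : forall i x, dom i x -> (met i x)^T = met i x;
  met_pos : forall i x (v : 'rV[R]_n), dom i x -> v != 0 ->
    0 < (v *m met i x *m v^T) 0 0;
  met_trans : forall i j x, dom i x -> dom j x ->
    met i x = trans i j x *m met j x *m (trans i j x)^T }.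

Section riemannian.
Variables (R : realType) (n : nat) (M : manifold R n) (g : metric M).
Implicit Types (i : chart M) (x : M).

Definition ip i x (v w : 'rV[R]_n) : R := (v *m g i x *m w^T) 0 0.

Definition dmet i x (k s l : 'I_n) : R :=
  pd i (delta_mx 0 k) (fun y => g i y s l : R^o) x.

(* Christoffel symbol Gamma^l_{k r}. *)
Definition christoffel i x (l k r : 'I_n) : R :=
  2^-1 * \sum_s invmx (g i x) l s *
           (dmet i x k s r + dmet i x r s k - dmet i x s k r).

(* Levi-Civita derivative along v of the vector field with components Y. *)
Definition nabla_LC i (v : 'rV[R]_n) (Y : M -> 'rV[R]_n) x : 'rV[R]_n :=
  pd i v Y x +
  \row_l \sum_k \sum_r christoffel i x l k r * v 0 k * Y x 0 r.

End riemannian.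

(* A real 8-dimensional module over Cl(R^6), with the Euclidean inner product *)
(* as invariant metric.  Irreducibility is automatic: the convention          *)
(* v.v = -|v|^2 gives Cl(R^6) = M_8(R).  For the same reason the model is     *)
(* unique up to isometry.                                                     *)
Record clifford_model (R : realType) := CliffordModel {
  gam :> 'I_6 -> 'M[R]_8;
  gam_clifford : forall p q,
    gam p *m gam q + gam q *m gam p = (- 2 *+ (p == q))%:M;
  gam_skew : forall p, (gam p)^T = - gam p }.

Section spin_group.
Variables (R : realType) (gm : clifford_model R).

Definition gamv (v : 'rV[R]_6) : 'M[R]_8 := \sum_p v 0 p *: gm p.

(* Spin(6), in its (faithful) action on the Clifford module: the products of  *)
(* an even number of unit vectors.                                            *)
Definition Spin6 : set 'M[R]_8 :=
  [set s | exists vs : seq 'rV[R]_6,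
     [/\ ~~ odd (size vs), (forall v, v \in vs -> \sum_p v 0 p ^+ 2 = 1)
       & s = \prod_(v <- vs) gamv v]].

End spin_group.

(* A spin structure on an oriented Riemannian six-manifold, presented by      *)
(* local oriented orthonormal frames (sp_frame a i x has as rows the frame    *)
(* vectors, in chart i) together with a Spin(6)-valued cocycle sp_lift        *)
(* lifting the SO(6)-valued transition functions of the frames.  Since        *)
(* sp_frame a i x *m g *m w^T lists the components of w in the frame a,       *)
(* sp_lift_frame says that the covering Spin(6) -> SO(6) sends sp_lift a b to *)
(* the transition function between the frames.                                *)
Record spin_structure (R : realType) (gm : clifford_model R) (M : manifold R 6)
    (g : metric M) := SpinStructure {
  sp_idx : Type;
  sp_dom : sp_idx -> set M;
  sp_dom_open : forall a, open (sp_dom a);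
  sp_dom_cover : forall x, exists a, sp_dom a x;
  sp_frame : sp_idx -> chart M -> M -> 'M[R]_6;
  sp_frame_smooth : forall a i, smooth_fun (sp_dom a `&` dom i) (sp_frame a i);
  sp_frame_trans : forall a i j x, sp_dom a x -> dom i x -> dom j x ->
    sp_frame a j x = sp_frame a i x *m trans i j x;
  sp_frame_orthonormal : forall a i x, sp_dom a x -> dom i x ->
    sp_frame a i x *m g i x *m (sp_frame a i x)^T = 1%:M;
  sp_frame_oriented : forall a i x, sp_dom a x -> dom i x ->
    0 < \det (sp_frame a i x);
  sp_lift : sp_idx -> sp_idx -> M -> 'M[R]_8;
  sp_lift_smooth : forall a b, smooth_fun (sp_dom a `&` sp_dom b) (sp_lift a b);
  sp_lift_Spin : forall a b x, sp_dom a x -> sp_dom b x ->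
    Spin6 gm (sp_lift a b x);
  sp_lift_frame : forall a b i x (w : 'rV[R]_6),
    sp_dom a x -> sp_dom b x -> dom i x ->
    sp_lift a b x *m gamv gm (sp_frame b i x *m g i x *m w^T)^T =
    gamv gm (sp_frame a i x *m g i x *m w^T)^T *m sp_lift a b x;
  sp_lift_cocycle : forall a b c x, sp_dom a x -> sp_dom b x -> sp_dom c x ->
    sp_lift a b x *m sp_lift b c x = sp_lift a c x }.

(* Sections of the spinor bundle SM associated with the spin structure. *)
Record spinor_field (R : realType) (gm : clifford_model R) (M : manifold R 6)
    (g : metric M) (S : spin_structure gm g) := SpinorField {
  spf :> sp_idx S -> M -> 'cV[R]_8;
  spf_smooth : forall a, smooth_fun (sp_dom a) (spf a);
  spf_trans : forall a b x, sp_dom a x -> sp_dom b x ->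
    spf a x = sp_lift a b x *m spf b x }.

Section spin_geometry.
Variables (R : realType) (gm : clifford_model R) (M : manifold R 6).
Variables (g : metric M) (S : spin_structure gm g).
Implicit Types (a : sp_idx S) (i : chart M) (x : M).

(* e_p, the p-th vector of the frame a. *)
Definition fvec a i x (p : 'I_6) : 'rV[R]_6 := row p (sp_frame a i x).

(* Clifford multiplication by the tangent vector v. *)
Definition cmul a i x (v : 'rV[R]_6) : 'M[R]_8 :=
  \sum_p ip g i x v (fvec a i x p) *: gm p.

(* Action of a two-form with values in 'rV_m on a spinor s, through           *)
(* e^p /\ e^q |-> e^p e^q; the result lies in R^8 (x) R^m = 'M_(8, m).        *)
Definition form2_act (m : nat) a i x (om : 'M[R]_(2, 6) -> 'rV[R]_m)
    (s : 'cV[R]_8) : 'M[R]_(8, m) :=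
  \sum_(p < 6) \sum_(q < 6 | (p < q)%N)
     (gm p *m gm q *m s) *m om (col_mx (fvec a i x p) (fvec a i x q)).

(* Levi-Civita derivative of spinors,                                         *)
(* v(s) + 1/4 sum_{p,q} g(nabla_v e_p, e_q) e_p e_q s.                        *)
Definition nabla_spin a i (v : 'rV[R]_6) (s : M -> 'cV[R]_8) x : 'cV[R]_8 :=
  pd i v s x + 4^-1 *: \sum_p \sum_q
    ip g i x (nabla_LC g i v (fun y => fvec a i y p) x) (fvec a i x q)
      *: (gm p *m gm q *m s x).

Definition unit_spinor (psi : spinor_field S) : Prop :=
  forall a x, sp_dom a x -> ((psi a x)^T *m psi a x) 0 0 = 1.

Definition killing_spinor (psi : spinor_field S) : Prop :=
  forall a i x (v : 'rV[R]_6), sp_dom a x -> dom i x ->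
    nabla_spin a i v (psi a) x = 2^-1 *: (cmul a i x v *m psi a x).

Definition nearly_kahler (psi : spinor_field S) : Prop :=
  [/\ oriented_atlas M, unit_spinor psi & killing_spinor psi].

End spin_geometry.

(* A principal K-bundle, presented by its transition functions: over          *)
(* pb_dom a it has a local section sigma_a, and sigma_b = sigma_a . pb_tr a b.  *)
Record principal_bundle (R : realType) (n m : nat) (M : manifold R n)
    (K : lie_group R m) := PrincipalBundle {
  pb_idx : Type;
  pb_dom : pb_idx -> set M;
  pb_dom_open : forall a, open (pb_dom a);
  pb_dom_cover : forall x, exists a, pb_dom a x;
  pb_tr : pb_idx -> pb_idx -> M -> K;
  pb_tr_smooth : forall a b, smooth_map (pb_dom a `&` pb_dom b) (pb_tr a b);
  pb_tr_cocycle : forall a b c x, pb_dom a x -> pb_dom b x -> pb_dom c x ->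
    lg_mul (pb_tr a b x) (pb_tr b c x) = pb_tr a c x }.

(* A connection, presented by the local gauge potentials sigma_a^* A: at x, in *)
(* chart i, the potential is the Lie algebra valued covector v |-> v *m cn a i x. *)
Record connection (R : realType) (n m : nat) (M : manifold R n)
    (K : lie_group R m) (P : principal_bundle M K) := Connection {
  cn :> pb_idx P -> chart M -> M -> 'M[R]_(n, m);
  cn_smooth : forall a i, smooth_fun (pb_dom a `&` dom i) (cn a i);
  cn_trans : forall a i j x, pb_dom a x -> dom i x -> dom j x ->
    cn a i x = trans i j x *m cn a j x;
  cn_gauge : forall a b i x (v : 'rV[R]_n),
    pb_dom a x -> pb_dom b x -> dom i x ->
    v *m cn b i x = v *m cn a i x *m Ad (lg_inv (pb_tr a b x)) +
                    maurer_cartan i (pb_tr a b) v x }.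

(* Sections of Ad_P (x) T^*M. *)
Record ad_one_form (R : realType) (n m : nat) (M : manifold R n)
    (K : lie_group R m) (P : principal_bundle M K) := AdOneForm {
  af :> pb_idx P -> chart M -> M -> 'M[R]_(n, m);
  af_smooth : forall a i, smooth_fun (pb_dom a `&` dom i) (af a i);
  af_trans : forall a i j x, pb_dom a x -> dom i x -> dom j x ->
    af a i x = trans i j x *m af a j x;
  af_gauge : forall a b i x,
    pb_dom a x -> pb_dom b x -> dom i x ->
    af a i x = af b i x *m Ad (pb_tr a b x) }.

(* Lie algebra valued k-forms in a chart: the rows of the matrix argument are *)
(* the k vectors on which the form is evaluated.                              *)
Section forms.
Variables (R : realType) (n m : nat) (M : manifold R n) (K : lie_group R m).
Implicit Types (i : chart M) (x : M).

Definition lform (k : nat) := M -> 'M[R]_(k, n) -> 'rV[R]_m.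

Definition form1 (al : M -> 'M[R]_(n, m)) : lform 1 := fun x v => v *m al x.

(* The arguments are extended to vector fields with constant components in    *)
(* chart i, so that no commutator terms appear.                               *)
Definition ext_d i (k : nat) (om : lform k) : lform k.+1 := fun x V =>
  \sum_(j < k.+1) (-1) ^+ j *: pd i (row j V) (fun y => om y (row' j V)) x.

(* [al /\ om] *)
Definition wedge_bracket (k : nat) (al : M -> 'M[R]_(n, m)) (om : lform k) :
    lform k.+1 := fun x V =>
  \sum_(j < k.+1)
    (-1) ^+ j *: @lie_bracket R m K (row j V *m al x) (om x (row' j V)).

(* d^A om = d om + [A /\ om] *)
Definition cov_d i (k : nat) (A : M -> 'M[R]_(n, m)) (om : lform k) :
    lform k.+1 := fun x V => ext_d i om x V + wedge_bracket A om x V.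

(* F = dA + 1/2 [A /\ A] *)
Definition curvature i (A : M -> 'M[R]_(n, m)) : lform 2 := fun x V =>
  ext_d i (form1 A) x V + 2^-1 *: wedge_bracket A (form1 A) x V.

End forms.

(* Hodge star of a one-form: *al is the contraction of the volume form        *)
(* sqrt(det g) dx^1 /\ ... /\ dx^6 with the vector field g^-1 al.             *)
Definition hodge1 (R : realType) (m : nat) (M : manifold R 6) (g : metric M)
    (i : chart M) (al : M -> 'M[R]_(6, m)) : lform m M 5 := fun x V =>
  \sum_(k < 6)
    (Num.sqrt (\det (g i x)) *
       \det (col_mx (delta_mx 0 k : 'rV[R]_6) V : 'M[R]_6))
    *: row k (invmx (g i x) *m al x).

Section instantons.
Variables (R : realType) (gm : clifford_model R) (M : manifold R 6).
Variables (g : metric M) (S : spin_structure gm g) (psi : spinor_field S).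
Variables (m : nat) (K : lie_group R m) (P : principal_bundle M K).

(* F . psi = 0 *)
Definition instanton (A : connection P) : Prop :=
  forall (a : sp_idx S) (b : pb_idx P) (i : chart M) (x : M),
    sp_dom a x -> pb_dom b x -> dom i x ->
    form2_act a i x (curvature K i (A b i) x) (psi a x) = 0.

(* d^A eps . psi = 0 *)
Definition linearised_instanton (A : connection P) (eps : ad_one_form P) : Prop :=
  forall (a : sp_idx S) (b : pb_idx P) (i : chart M) (x : M),
    sp_dom a x -> pb_dom b x -> dom i x ->
    form2_act a i x (cov_d K i (A b i) (form1 (eps b i)) x) (psi a x) = 0.

(* d^A * eps = 0 *)
Definition gauge_fixed (A : connection P) (eps : ad_one_form P) : Prop :=
  forall (b : pb_idx P) (i : chart M) (x : M) (V : 'M[R]_6),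
    pb_dom b x -> dom i x ->
    cov_d K i (A b i) (hodge1 g i (eps b i)) x V = 0.

Definition infinitesimal_deformation (A : connection P) (eps : ad_one_form P) :
    Prop := linearised_instanton A eps /\ gauge_fixed A eps.

Definition ad_form_zero (eps : ad_one_form P) : Prop :=
  forall (b : pb_idx P) (i : chart M) (x : M),
    pb_dom b x -> dom i x -> eps b i x = 0.

Definition rigid (A : connection P) : Prop :=
  forall eps : ad_one_form P, infinitesimal_deformation A eps -> ad_form_zero eps.

End instantons.

(* Main.v *)
(* Since K is abelian, Ad is trivial and each Lie algebra component of eps is  *)
(* a globally defined real one-form e, with norm |e|^2.  The spinor eta = e.psi *)
(* has the same norm as e, and the two deformation equations together with the *)
(* Killing equation say that D eta = 2 eta for the Dirac operator D.           *)
(* Lichnerowicz' formula D^2 = nabla^* nabla + scal/4, with scal = 30 by the    *)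
(* Killing equation, then gives                                                *)
(*     Laplacian |e|^2 = 2 |nabla eta|^2 + 7 |e|^2,                            *)
(* so that e = 0 at a maximum of |e|^2, by the second derivative test.         *)
(* The computation is done in coordinates, modulo first derivatives of |e|^2,  *)
(* and algebraically, over the ring of smooth functions on a chart domain with *)
(* its commuting derivations d/dx^k.                                           *)
Require Import Defs.
From mathcomp Require Import all_boot all_order all_algebra.
From mathcomp Require Import all_classical all_reals all_analysis.
From HB Require Import structures.
From mathcomp Require Import perm ring lra.
(* all_algebra shadows the chart coordinates coord of Defs. *)
Import Defs.
Import Order.TTheory GRing.Theory Num.Theory.
Import numFieldNormedType.Exports.
Local Open Scope classical_set_scope.
Local Open Scope ring_scope.

Set Implicit Arguments.
Unset Strict Implicit.
Unset Printing Implicit Defensive.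

(** * Clifford algebra *)

(** For abelian [K] the adjoint action and the bracket vanish from all equations ([Ad1],
    [wedge_bracket0]), so a component e of the deformation in the Lie algebra satisfies de . psi = 0
    and d * e = 0. In D(e . psi) = sum_k gamma^k nabla_k (e . psi), the derivative of e contributes
    de . psi minus the divergence of e times psi, which is zero. The derivative of psi contributes
    1/2 sum_k gamma^k e gamma_k psi = (6 - 2)/2 e . psi. Hence eta = e . psi has D eta = 2 eta
    ([dirac_eta]), and |eta| = |e| because psi is a unit spinor ([eta_dot]).

    The curvature term of D^2 is a scalar by the first Bianchi identity ([curvature_scalar],
    [curv_contract_scalar]). Its value is read off from psi, whose curvature follows from the
    Killing equation ([killing_curv], [curv_contract_eq]); this gives D^2 = nabla^* nabla + 15/2
    ([dirac_sq]). Comparison with D^2 eta = 4 eta leaves nabla^* nabla eta = - 7/2 eta, and pairing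
    with eta gives [weitzenboeck_eq]. All of this holds over a commutative ring with commuting
    derivations that contains 1/2 and 1/3.

    The ring [smooth_fct] turns it into a statement about functions in a chart, where the second
    derivative test forces |e|^2 <= 0 at a maximum ([local_vanishing]). By compactness the global
    function [normsq] has a maximum, so e = 0. *)

Lemma sumr_pick (V : nmodType) (I : finType) (F : I -> V) (p : I) :
  \sum_q F q *+ (p == q) = F p.
Proof.
rewrite (bigD1 p) //= eqxx big1 ?addr0 // => q /negPf.
by rewrite eq_sym => ->.
Qed.

Lemma sum_rot (V : nmodType) n (F : 'I_n -> 'I_n -> 'I_n -> V) :
  \sum_p \sum_q \sum_r F p q r = \sum_p \sum_q \sum_r F r p q.
Proof. by rewrite exchange_big; apply: eq_bigr => q _; rewrite exchange_big. Qed.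

Lemma mulmxMnl (A : pzRingType) m n p k (X : 'M[A]_(m, n)) (Y : 'M[A]_(n, p)) :
  (X *+ k) *m Y = (X *m Y) *+ k.
Proof. exact: (raddfMn (mulmxr Y)). Qed.

Lemma mulmxMnr (A : pzRingType) m n p k (X : 'M[A]_(m, n)) (Y : 'M[A]_(n, p)) :
  X *m (Y *+ k) = (X *m Y) *+ k.
Proof. exact: (raddfMn (mulmx X)). Qed.

Section clifford_algebra.
Variables (A : comPzRingType) (n N : nat) (g : 'I_n -> 'M[A]_N).
Hypothesis gC : forall p q, g p *m g q + g q *m g p = (- 2%:R *+ (p == q))%:M.
Variables (h : A).
Hypothesis hE : h + h = 1.

Definition clif (v : 'rV[A]_n) : 'M[A]_N := \sum_p v 0 p *: g p.

Fact clif_is_linear : linear clif.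
Proof.
move=> a u v; rewrite /clif scaler_sumr -big_split; apply: eq_bigr => p _.
by rewrite !mxE scalerDl scalerA.
Qed.
HB.instance Definition _ := GRing.isLinear.Build A 'rV[A]_n 'M[A]_N _ clif clif_is_linear.

Lemma clifZ a v : clif (a *: v) = a *: clif v.
Proof. exact: linearZ. Qed.

Lemma clif_delta p : clif (delta_mx 0 p) = g p.
Proof.
rewrite /clif -[RHS](@sumr_pick _ _ g p); apply: eq_bigr => q _.
by rewrite mxE eqxx eq_sym; case: eqP; rewrite (scale1r, scale0r).
Qed.

(** Division by 2 is available only through [h]; besides cancelling factors it gives the vanishing
    of quantities equal to their own opposite. *)
Lemma half_eq0 (V : lmodType A) (v : V) : v + v = 0 -> v = 0.
Proof. by move=> vv; rewrite -[v]scale1r -hE scalerDl -scalerDr vv scaler0. Qed.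

Lemma swap_g p q : g q *m g p = - (g p *m g q) - 2%:R%:M *+ (p == q).
Proof.
apply/eqP; rewrite -subr_eq0 !opprD !opprK addrA (addrC (g q *m _)) gC.
by rewrite raddfMn /= raddfN /= mulNrn addNr.
Qed.

Lemma g_sq p : g p *m g p = - 1%:M.
Proof.
apply/eqP; rewrite -subr_eq0 opprK; apply/eqP/half_eq0.
by rewrite addrACA gC eqxx mulr1n raddfN /= mulr2n raddfD /= addNr.
Qed.

Lemma dotE (v w : 'rV[A]_n) : (v *m w^T) 0 0 = \sum_p v 0 p * w 0 p.
Proof. by rewrite mxE; apply: eq_bigr => p _; rewrite mxE. Qed.

Lemma clif_anti v w :
  clif v *m clif w + clif w *m clif v = - (2%:R * (v *m w^T) 0 0)%:M.
Proof.
rewrite /clif !mulmx_suml.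
under eq_bigr do rewrite mulmx_sumr.
under [X in _ + X]eq_bigr do rewrite mulmx_sumr.
rewrite [X in _ + X]exchange_big -big_split /= dotE mulr_sumr raddf_sum -sumrN.
apply: eq_bigr => p _; rewrite -big_split /=.
rewrite -[RHS](sumr_pick (fun q => - (2%:R * (v 0 p * w 0 q))%:M) p).
apply: eq_bigr => q _.
rewrite -!scalemxAl -!scalemxAr !scalerA (mulrC (w _ _)) -scalerDr gC.
case: (p == q); rewrite ?mulr0n ?mulr1n ?raddf0 ?scaler0 //.
rewrite scale_scalar_mx -raddfN /=; congr (scalar_mx _); ring.
Qed.

Lemma clif_sq v : clif v *m clif v = - ((v *m v^T) 0 0)%:M.
Proof.
apply/eqP; rewrite -subr_eq0 opprK; apply/eqP/half_eq0.
by rewrite addrACA clif_anti -[_%:M + _%:M]raddfD /= -mulr2n mulr_natl addNr.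
Qed.

(** Clifford multiplication by the two-tensor [M]; its symmetric part contributes only a multiple of
    the identity. *)
Definition quad (M : 'M[A]_n) : 'M[A]_N :=
  \sum_p \sum_q M p q *: (g p *m g q).

Fact quad_is_linear : linear quad.
Proof.
move=> a u v; rewrite /quad.
rewrite scaler_sumr -big_split; apply: eq_bigr => p _ /=.
rewrite scaler_sumr -big_split; apply: eq_bigr => q _ /=.
by rewrite !mxE scalerDl scalerA.
Qed.
HB.instance Definition _ := GRing.isLinear.Build A 'M[A]_n 'M[A]_N _ quad quad_is_linear.

Lemma quad_row M : quad M = \sum_p g p *m clif (row p M).
Proof.
apply: eq_bigr => p _; rewrite mulmx_sumr; apply: eq_bigr => q _.
by rewrite -scalemxAr mxE.
Qed.

Lemma quad_col M : quad M = \sum_q clif (row q M^T) *m g q.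
Proof.
rewrite /quad exchange_big; apply: eq_bigr => p _; rewrite mulmx_suml.
by apply: eq_bigr => q _; rewrite -scalemxAl !mxE.
Qed.

(** With [h * h] = 1/4 this is the spin representation of so(n) on antisymmetric matrices. *)
Definition spinW (omega : 'M[A]_n) : 'M[A]_N := (h * h) *: quad omega.

Fact spinW_is_linear : linear spinW.
Proof.
move=> a u v; rewrite /spinW scalerA (mulrC a) -(scalerA (h * h) a) -scalerDr.
by congr (_ *: _); exact: quad_is_linear.
Qed.
HB.instance Definition _ := GRing.isLinear.Build A 'M[A]_n 'M[A]_N _ spinW spinW_is_linear.

(** Moving [g r] past both factors changes the sign twice, so only the contractions of r with p and
    q remain. *)
Lemma comm_g2 p q r :
  g p *m g q *m g r - g r *m (g p *m g q) =
  (2%:R *: g q) *+ (r == p) - (2%:R *: g p) *+ (r == q).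
Proof.
rewrite -mulmxA (swap_g r q) mulmxBr mulmxN.
rewrite [g r *m (_ *m _)]mulmxA (swap_g p r) [p == r]eq_sym mulmxBl mulNmx.
rewrite -!mulmxA opprD !opprK addrACA addNr add0r [RHS]addrC.
congr (_ + _); last by case: (r == p); rewrite ?mulr0n ?mulr1n ?mul0mx ?mul_scalar_mx.
by case: (r == q); rewrite ?mulr0n ?mulr1n ?mulmx0 ?mul_mx_scalar.
Qed.

Lemma clif_mulmx (v : 'rV[A]_n) (M : 'M[A]_n) :
  clif (v *m M) = \sum_r v 0 r *: clif (row r M).
Proof.
rewrite mulmx_sum_row raddf_sum; apply: eq_bigr => r _; exact: clifZ.
Qed.

Lemma half_half (V : lmodType A) (v : V) : (h * h) *: (v *+ 4) = v.
Proof.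
have h2 (w : V) : h *: (w *+ 2) = w by rewrite mulr2n scalerDr -scalerDl hE scale1r.
by rewrite -scalerA -[4%N]/(2 * 2)%N mulrnA !h2.
Qed.

(** Each contraction in [comm_g2] carries a 2 and antisymmetry of [omega] doubles it again, which
    the 1/4 cancels. This is why Clifford multiplication is parallel ([nabS_clif]). *)
Lemma spinW_comm omega v : omega^T = - omega ->
  spinW omega *m clif v - clif v *m spinW omega = clif (v *m omega).
Proof.
move=> omT.
have omega_anti p q : omega p q = - omega q p.
  by rewrite -[in RHS](trmxK omega) omT !mxE opprK.
have Wg r : spinW omega *m g r - g r *m spinW omega = clif (row r omega).
  rewrite -[RHS]half_half /spinW -scalemxAl -scalemxAr -scalerBr; congr (_ *: _).
  rewrite /quad mulmx_suml mulmx_sumr -sumrB.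
  have E p : (\sum_q omega p q *: (g p *m g q)) *m g r -
      g r *m (\sum_q omega p q *: (g p *m g q)) =
      (\sum_q omega p q *: g q *+ 2) *+ (r == p) - (omega p r *: g p) *+ 2.
    rewrite mulmx_suml mulmx_sumr -sumrB.
    rewrite -[X in _ - X](sumr_pick (fun q => (omega p q *: g p) *+ 2) r) -sumrMnl -sumrB.
    apply: eq_bigr => q _; rewrite -scalemxAl -scalemxAr -scalerBr comm_g2.
    by rewrite scalerBr !scaler_nat -!scalerMnr.
  under eq_bigr do rewrite E.
  rewrite sumrB sumr_pick /clif -sumrMnl -sumrB; apply: eq_bigr => p _.
  by rewrite mxE (omega_anti p r) scaleNr mulNrn opprK -mulrnDr.
rewrite clif_mulmx /clif mulmx_suml mulmx_sumr -sumrB; apply: eq_bigr => r _.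
by rewrite -scalemxAl -scalemxAr -scalerBr Wg.
Qed.

(** The commutator with [spinW omega] is a derivation, evaluated on the two factors of [g p *m g q]
    by [spinW_comm]. The order on the right is reversed because matrices act on row vectors. *)
Lemma spinW_bracket omega om' : omega^T = - omega ->
  spinW omega *m spinW om' - spinW om' *m spinW omega =
  spinW (om' *m omega - omega *m om').
Proof.
move=> omT.
have Wg r : spinW omega *m g r - g r *m spinW omega = clif (row r omega).
  by rewrite -clif_delta spinW_comm // rowE.
have commM (X Y Z : 'M[A]_N) : X *m (Y *m Z) - (Y *m Z) *m X =
    (X *m Y - Y *m X) *m Z + Y *m (X *m Z - Z *m X).
  by rewrite mulmxBl mulmxBr !mulmxA addrA subrK.
rewrite {2 3}/spinW -scalemxAl -scalemxAr -scalerBr [RHS]/spinW; congr (_ *: _).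
rewrite raddfB /= [RHS]addrC [quad (omega *m om')]quad_col trmx_mul omT mulmxN.
rewrite [quad (om' *m omega)]quad_row -sumrN {1 2}/quad mulmx_suml mulmx_sumr -sumrB.
under eq_bigr do [rewrite mulmx_suml mulmx_sumr -sumrB].
under eq_bigr do [under eq_bigr do
  rewrite -scalemxAl -scalemxAr -scalerBr commM !Wg scalerDr].
under eq_bigr do rewrite big_split.
rewrite big_split /=; congr (_ + _).
  rewrite exchange_big; apply: eq_bigr => q _ /=.
  rewrite !raddfN /= mulNmx opprK row_mul clif_mulmx mulmx_suml.
  by apply: eq_bigr => p _; rewrite !mxE -scalemxAl.
apply: eq_bigr => p _; rewrite row_mul clif_mulmx mulmx_sumr.
by apply: eq_bigr => q _; rewrite mxE -scalemxAr.
Qed.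

Lemma spinWZ a v : spinW (a *: v) = a *: spinW v.
Proof. exact: linearZ. Qed.

Lemma delta_dot p (v : 'rV[A]_n) : ((delta_mx 0 p : 'rV[A]_n) *m v^T) 0 0 = v 0 p.
Proof. by rewrite -rowE !mxE. Qed.

(** Anticommuting gives g_p v g_p = v - 2 v_p g_p for each p, and the corrections add up to -2 v. *)
Lemma clif_contract (v : 'rV[A]_n) :
  \sum_p g p *m clif v *m g p = (n%:R - 2%:R) *: clif v.
Proof.
have E p : g p *m clif v *m g p = clif v - (v 0 p *: g p) *+ 2.
  have H := clif_anti (delta_mx 0 p) v; rewrite clif_delta in H.
  rewrite -[g p *m clif v](addrK (clif v *m g p)) H delta_dot.
  rewrite mulmxBl mulNmx mul_scalar_mx -mulmxA g_sq mulmxN mulmx1 opprK addrC.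
  by rewrite mulr_natl scalerMnl.
under eq_bigr do rewrite E.
rewrite sumrB sumr_const card_ord scalerBl scaler_nat; congr (_ - _).
by rewrite sumrMnl scaler_nat.
Qed.

(* Summed over the cyclic permutations of p, q, r, the products g_p g_q g_r    *)
(* cancel by the Bianchi identity; only the corrections from reordering, which *)
(* are Ricci contractions, survive, and the Ricci tensor is symmetric.         *)
Lemma curvature_scalar (t : A) (R4 : 'I_n -> 'I_n -> 'I_n -> 'I_n -> A) :
  t *+ 3 = 1 ->
  (forall p q r s, R4 q p r s = - R4 p q r s) ->
  (forall p q r s, R4 p q s r = - R4 p q r s) ->
  (forall p q r s, R4 p q r s + R4 q r p s + R4 r p q s = 0) ->
  exists c, \sum_p \sum_q \sum_r \sum_s
    R4 p q r s *: (g p *m g q *m g r *m g s) = c%:M.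
Proof.
move=> tE R12 R34 RB.
have third (V : lmodType A) (v : V) : v *+ 3 = 0 -> v = 0.
  by move=> v3; rewrite -[v]scale1r -tE -scalerMnl scalerMnr v3 scaler0.
(* The Ricci tensor; its symmetry is the Bianchi identity with the last index contracted. *)
pose rho : 'M[A]_n := \matrix_(q, s) \sum_p R4 p q p s.
have rhoT : rho^T = rho.
  apply/matrixP => q s; rewrite !mxE; apply/eqP; rewrite -subr_eq0 -sumrB.
  apply/eqP; apply: big1 => p _.
  have := RB p q s p.
  have -> : R4 q s p p = 0.
    by apply: (@half_eq0 A^o); rewrite {1}R34 addNr.
  by rewrite addr0 (R34 p q p s) (R12 p s q p) (R34 p s p q) opprK addrC.
have B s : \sum_p \sum_q \sum_r R4 p q r s *: (g p *m g q *m g r) = clif (row s rho) *+ 2.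
  have cyc p q r : g p *m g q *m g r + (g q *m g r *m g p + g r *m g p *m g q) =
      g p *m g q *m g r *+ 3 + (g r *+ 2) *+ (p == q) + (g p *+ 2) *+ (q == r)
      - (g q *+ 4) *+ (p == r).
    rewrite -[g q *m g r *m g p]mulmxA (swap_g p r) mulmxBr mulmxN mulmxA (swap_g p q).
    rewrite !mulmxBl !mulNmx -[g p *m g r *m g q]mulmxA (swap_g q r) mulmxBr mulmxN !mulmxA.
    rewrite !mulmxMnl !mulmxMnr !mul_scalar_mx !mul_mx_scalar !scaler_nat.
    move: (g p *m g q *m g r) => X; rewrite -!mulrnA ![(2 * _)%N]mulnC.
    by case: (p == q); case: (q == r); case: (p == r);
      apply/matrixP => i j; rewrite !mxE; ring.
  have : \sum_p \sum_q \sum_r R4 p q r s *: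
      (g p *m g q *m g r + (g q *m g r *m g p + g r *m g p *m g q)) = 0.
    under eq_bigr do under eq_bigr do under eq_bigr do rewrite !scalerDr.
    under eq_bigr do under eq_bigr do rewrite !big_split.
    under eq_bigr do rewrite !big_split.
    rewrite !big_split /=.
    rewrite (sum_rot (fun p q r => R4 p q r s *: (g q *m g r *m g p))).
    rewrite [X in _ + (_ + X)]sum_rot [X in _ + (_ + X)]sum_rot.
    rewrite -!big_split big1 // => p _; rewrite -!big_split big1 // => q _.
    rewrite -!big_split big1 // => r _ /=.
    by rewrite -!scalerDl [X in _ + X]addrC addrA RB scale0r.
  (* The multiplicities are abstracted because big_split would otherwise *)
  (* unfold x *+ 2 to x + x.                                             *)
  have [k2 [k3 [k4 [k2E k3E k4E E]]]] : exists k2 k3 k4, [/\ k2 = 2, k3 = 3, k4 = 4 &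
      forall p q r, R4 p q r s *:
        (g p *m g q *m g r + (g q *m g r *m g p + g r *m g p *m g q)) =
        (R4 p q r s *: (g p *m g q *m g r)) *+ k3 + ((R4 p q r s *: g r) *+ k2) *+ (p == q)
        + ((R4 p q r s *: g p) *+ k2) *+ (q == r) - ((R4 p q r s *: g q) *+ k4) *+ (p == r)].
    exists 2, 3, 4; split=> // p q r.
    by rewrite cyc scalerBr !scalerDr -!scalerMnr.
  under eq_bigr do under eq_bigr do under eq_bigr do rewrite E.
  under eq_bigr do under eq_bigr do rewrite sumrB !big_split /= !sumr_pick !sumrMnl.
  under eq_bigr do rewrite sumrB !big_split /= sumr_pick !sumrMnl.
  rewrite sumrB !big_split /= !sumrMnl.
  have -> : \sum_p \sum_q R4 p p q s *: g q = 0.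
    apply: big1 => p _; apply: big1 => q _.
    have -> : R4 p p q s = 0 by apply: (@half_eq0 A^o); rewrite {1}R12 addNr.
    by rewrite scale0r.
  have -> : \sum_p \sum_q R4 p q q s *: g p = - clif (row s rho).
    rewrite exchange_big /= -sumrN exchange_big; apply: eq_bigr => q _.
    rewrite -rhoT !mxE scaler_suml -sumrN; apply: eq_bigr => p _.
    by rewrite R12 scaleNr.
  have -> : \sum_p \sum_q R4 p q p s *: g q = clif (row s rho).
    rewrite exchange_big; apply: eq_bigr => q _.
    by rewrite -rhoT !mxE scaler_suml.
  (* With X the triple sum and r the Ricci vector, the cyclic sum reads 0 = 3 X - 2 r - 4 r, so X =
     2 r. *)
  move=> H; apply/eqP; rewrite -subr_eq0; apply/eqP/third; rewrite -[RHS]H k2E k3E k4E.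
  by apply/matrixP => i j; rewrite !mxE; ring.
(* As [rho] is symmetric, only the trace survives, with g_p g_p = -1. *)
have quad_rho : quad rho *+ 2 = - (2%:R * \tr rho)%:M.
  rewrite mulr2n {2}/quad exchange_big -big_split mulr_sumr raddf_sum -sumrN /=.
  apply: eq_bigr => p _; rewrite -big_split /=.
  rewrite -[RHS](sumr_pick (fun q => - (2%:R * rho p q)%:M) p); apply: eq_bigr => q _.
  have -> : rho q p = rho p q by rewrite -[in LHS]rhoT mxE.
  rewrite -scalerDr gC scale_scalar_mx -raddfN -raddfMn.
  case: (p == q); rewrite ?(mulr0n, mulr1n) ?(oppr0, mulr0, raddf0, mulr0n)
    ?(mulr0, raddf0) ?raddf0 //.
  by rewrite mulrN mulrC.
pose c : A := - (2%:R * \tr rho); exists c; rewrite /c raddfN -quad_rho quad_col rhoT -sumrMnl.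
under eq_bigr do [under eq_bigr do rewrite exchange_big].
under eq_bigr do rewrite exchange_big.
rewrite exchange_big /=; apply: eq_bigr => s _; rewrite -mulmxMnl -B mulmx_suml.
apply: eq_bigr => p _; rewrite mulmx_suml.
apply: eq_bigr => q _; rewrite mulmx_suml.
by apply: eq_bigr => r _; rewrite scalemxAl.
Qed.
End clifford_algebra.

(** * The Weitzenboeck identity over a differential ring *)

(* Additive identities between matrices, with matrix products as atoms. *)
Ltac mx_ring :=
  apply/matrixP => ? ?;
  repeat match goal with
  | |- context [fun_of_matrix (Algebra.add ?X ?Y) ?i ?j] =>
      rewrite [fun_of_matrix (Algebra.add X Y) i j]mxE
  | |- context [fun_of_matrix (Algebra.opp ?X) ?i ?j] =>
      rewrite [fun_of_matrix (Algebra.opp X) i j]mxE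
  | |- context [fun_of_matrix (GRing.scale ?a ?X) ?i ?j] =>
      rewrite [fun_of_matrix (GRing.scale a X) i j]mxE
  | |- context [fun_of_matrix (Algebra.natmul ?X ?k) ?i ?j] =>
      rewrite [fun_of_matrix (Algebra.natmul X k) i j]mulmxnE
  | |- context [fun_of_matrix (Algebra.zero _) ?i ?j] =>
      rewrite [fun_of_matrix (Algebra.zero _) i j]mxE
  end; ring.

(** * Derivations of a commutative ring, applied to matrices and determinants *)

Section derivations.
Variables (A : comPzRingType) (d : {additive A -> A}).
Hypothesis dM : forall x y, d (x * y) = d x * y + x * d y.

Lemma der1 : d 1 = 0.
Proof.
have := dM 1 1; rewrite !mulr1 mul1r => /eqP.
by rewrite -[X in X == _]addr0 (inj_eq (addrI _)) => /eqP.
Qed.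

Lemma der_mulmx m n p (X : 'M[A]_(m, n)) (Y : 'M[A]_(n, p)) :
  map_mx d (X *m Y) = map_mx d X *m Y + X *m map_mx d Y.
Proof.
apply/matrixP => i j; rewrite !mxE raddf_sum -big_split; apply: eq_bigr => k _ /=.
by rewrite !mxE dM.
Qed.

Lemma der_scalemx m n a (X : 'M[A]_(m, n)) :
  map_mx d (a *: X) = d a *: X + a *: map_mx d X.
Proof. by apply/matrixP => i j; rewrite !mxE dM. Qed.

Lemma der_idmx n : map_mx d (1%:M : 'M[A]_n) = 0.
Proof. by apply/matrixP => i j; rewrite !mxE; case: (i == j); rewrite (der1, raddf0). Qed.

Lemma der_prod n (F : 'I_n -> A) :
  d (\prod_i F i) = \sum_i \prod_j (if j == i then d (F j) else F j).
Proof.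
elim: n F => [|n IH] F; first by rewrite !big_ord0 der1.
rewrite !big_ord_recl dM IH eqxx mulr_sumr; congr (_ + _).
by apply: eq_bigr => i _; rewrite big_ord_recl.
Qed.

(** Jacobi's formula: differentiate one row at a time and expand along that row. *)
Lemma der_det n (M : 'M[A]_n) : d (\det M) = \tr (map_mx d M *m \adj M).
Proof.
have detE : d (\det M) = \sum_i \det (\matrix_(k, j) (if k == i then d (M k j) else M k j)).
  rewrite raddf_sum [RHS]exchange_big; apply: eq_bigr => s _ /=.
  rewrite dM der_prod [X in X * _](_ : _ = 0) ?mul0r ?add0r ?mulr_sumr; last first.
    by case: (odd_perm s); rewrite ?expr0 ?expr1 ?raddfN /= der1 ?oppr0.
  by apply: eq_bigr => i _; congr (_ * _); apply: eq_bigr => j _; rewrite mxE.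
rewrite detE; apply: eq_bigr => i _; rewrite (expand_det_row _ i) [RHS]mxE.
apply: eq_bigr => j _; rewrite !mxE eqxx; congr (_ * (_ * \det _)).
by apply/matrixP => k l; rewrite !mxE eq_sym (negPf (neq_lift _ _)).
Qed.
End derivations.

(* G is the metric, the rows of E are an orthonormal frame, C k r l is the     *)
(* Christoffel symbol Gamma^l_{k r}, and h is 1/2.                             *)
Section weitzenboeck.
Notation n := 6.
Variables (A : comPzRingType) (N : nat) (d : 'I_n -> {additive A -> A}).
Hypothesis dM : forall k x y, d k (x * y) = d k x * y + x * d k y.
Hypothesis dC : forall k l x, d k (d l x) = d l (d k x).
Variables (h t : A).
Hypotheses (hE : h + h = 1) (tE : t *+ 3 = 1).
Variable g : 'I_n -> 'M[A]_N.
Hypothesis gC : forall p q, g p *m g q + g q *m g p = (- 2%:R *+ (p == q))%:M.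
Hypothesis gT : forall p, (g p)^T = - g p.
Notation D k := (map_mx (d k)).
Hypothesis gD : forall k p, D k (g p) = 0.
Variables (G E : 'M[A]_n) (C : 'I_n -> 'M[A]_n).
Hypotheses (GT : G^T = G) (EGE : E *m G *m E^T = 1%:M).
Hypothesis torsion_free : forall k r l, C k r l = C r k l.
Hypothesis metric_compat : forall k, C k *m G + (C k *m G)^T = D k G.
Notation clif := (clif g).
Notation spinW := (spinW g h).

(* The entry (l, p) of theta is the component of d/dx^l along e_p; the entry   *)
(* (p, q) of omega k is g(nabla_k e_p, e_q). *)
Definition theta := G *m E^T.
Definition omega k : 'M[A]_n := (D k E + E *m C k) *m theta.

Lemma E_theta : E *m theta = 1%:M. Proof. by rewrite mulmxA. Qed.
Lemma theta_E : theta *m E = 1%:M. Proof. exact: mulmx1C E_theta. Qed.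

(** Differentiate the orthonormality relation [EGE] and substitute metric compatibility. *)
Lemma omega_anti k : (omega k)^T = - omega k.
Proof.
have := congr1 (map_mx (d k)) EGE.
rewrite der_idmx // !der_mulmx // -metric_compat -map_trmx => H.
apply/eqP; rewrite -addr_eq0; apply/eqP.
rewrite -[RHS]H /omega /theta !trmx_mul !trmxK linearD /= GT.
rewrite (trmx_mul E) !(mulmxDl, mulmxDr) !mulmxA; mx_ring.
Qed.

(** The equation nabla_k d/dx^l = Gamma^r_{kl} d/dx^r in frame components, from differentiating
    [theta *m E] = 1. *)
Lemma der_theta k : D k theta + theta *m omega k = C k *m theta.
Proof.
have H : theta *m D k E *m theta = - D k theta.
  have := congr1 (map_mx (d k)) theta_E.
  rewrite der_idmx // der_mulmx // => /(congr1 (mulmx^~ theta)).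
  rewrite mulmxDl -mulmxA E_theta mulmx1 mul0mx => /eqP.
  by rewrite addrC addr_eq0 => /eqP.
by rewrite /omega mulmxA mulmxDr mulmxDl H addrA subrr add0r mulmxA theta_E mul1mx.
Qed.

(** The dual of [der_theta], for the coordinate covectors dx^l; it follows from antisymmetry of
    [omega]. *)
Lemma der_ET k : D k E^T + E^T *m omega k = - ((C k)^T *m E^T).
Proof.
have TE : E^T *m theta^T = 1%:M by rewrite -trmx_mul theta_E trmx1.
rewrite -[omega k]opprK -omega_anti /omega trmx_mul mulmxN mulmxA TE mul1mx.
by rewrite linearD /= trmx_mul map_trmx opprD addrA subrr add0r.
Qed.

(* gam_up k and gam_dn k are gamma^k and gamma_k, with coordinate indices.  The *)
(* derivatives nab and nabS act on the frame (spinor) index only: coordinate   *)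
(* indices are spectators, so that no Christoffel symbol enters nab_curv.      *)
Definition gam_up k : 'M[A]_N := clif (row k E^T).
Definition gam_dn k : 'M[A]_N := clif (row k theta).
Definition W k : 'M[A]_N := spinW (omega k).
Definition nab m k (X : 'M[A]_(m, n)) := D k X + X *m omega k.
Definition nabS m k (s : 'M[A]_(N, m)) := D k s + W k *m s.
(** The Riemann curvature, with coordinate indices k, l and frame indices inside the matrix; the
    products follow the action on rows from the right. *)
Definition Omega k l : 'M[A]_n :=
  D k (omega l) - D l (omega k) + omega l *m omega k - omega k *m omega l.

Lemma der_half k : d k h = 0.
Proof.
apply: (half_eq0 hE (V := A^o)); rewrite -raddfD hE; exact: der1.
Qed.

Lemma der_clif k v : D k (clif v) = clif (D k v).
Proof.
rewrite /clif raddf_sum; apply: eq_bigr => p _ /=.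
by rewrite der_scalemx // gD scaler0 addr0 mxE.
Qed.

Lemma der_spinW k M : D k (spinW M) = spinW (D k M).
Proof.
rewrite /spinW der_scalemx // dM der_half mul0r mulr0 addr0 scale0r add0r.
congr (_ *: _); rewrite raddf_sum; apply: eq_bigr => p _.
rewrite raddf_sum; apply: eq_bigr => q _ /=.
by rewrite der_scalemx // der_mulmx // !gD mul0mx mulmx0 addr0 scaler0 addr0 mxE.
Qed.

Lemma W_clif k v : W k *m clif v = clif v *m W k + clif (v *m omega k).
Proof. by rewrite -(spinW_comm gC hE v (omega_anti k)) addrC subrK. Qed.

Lemma nabS_clif m k v (s : 'M[A]_(N, m)) :
  nabS k (clif v *m s) = clif (nab k v) *m s + clif v *m nabS k s.
Proof.
rewrite /nabS /nab der_mulmx // der_clif raddfD /= mulmxA W_clif.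
rewrite mulmxDr !mulmxDl !mulmxA; mx_ring.
Qed.

Lemma W_tr k : (W k)^T = - W k.
Proof.
rewrite /W /spinW !linearZ /=; congr (_ *: _).
rewrite -raddfN /= -omega_anti /quad linear_sum exchange_big; apply: eq_bigr => q _ /=.
rewrite linear_sum; apply: eq_bigr => p _ /=.
rewrite linearZ /= trmx_mul !gT mulNmx mulmxN opprK.
by rewrite [in RHS]mxE.
Qed.

(** The spin connection is metric because [W k] is skew-symmetric. *)
Lemma nabS_dot m m' k (s : 'M[A]_(N, m)) (s' : 'M[A]_(N, m')) :
  D k (s^T *m s') = (nabS k s)^T *m s' + s^T *m nabS k s'.
Proof.
rewrite /nabS der_mulmx // linearD /= trmx_mul W_tr mulmxDl mulmxDr map_trmx.
rewrite mulmxN mulNmx mulmxA; mx_ring.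
Qed.

Lemma der_comm m m' k l (X : 'M[A]_(m, m')) : D k (D l X) = D l (D k X).
Proof. by apply/matrixP => i j; rewrite !mxE dC. Qed.

Lemma nab_curv m k l (X : 'M[A]_(m, n)) :
  nab k (nab l X) - nab l (nab k X) = X *m Omega k l.
Proof.
rewrite /nab /Omega; move: (omega k) (omega l) => ok ol.
rewrite !raddfD /= !der_mulmx // (der_comm k l) !(mulmxDl, mulmxDr, mulmxBr).
rewrite !mulmxN !mulmxA; mx_ring.
Qed.

Lemma spinW_Omega k l :
  spinW (Omega k l) = D k (W l) - D l (W k) + (W k *m W l - W l *m W k).
Proof.
by rewrite (spinW_bracket gC hE _ (omega_anti k)) /Omega !der_spinW -addrA !raddfD !raddfN.
Qed.

Lemma nabS_curv m k l (s : 'M[A]_(N, m)) :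
  nabS k (nabS l s) - nabS l (nabS k s) = spinW (Omega k l) *m s.
Proof.
rewrite spinW_Omega /nabS; move: (W k) (W l) => wk wl.
rewrite !raddfD /= !der_mulmx // (der_comm k l) !(mulmxDl, mulmxDr, mulNmx).
rewrite !mulmxA; mx_ring.
Qed.

Lemma nab_row m k l (X : 'M[A]_(m, n)) : nab k (row l X) = row l (nab k X).
Proof. by rewrite /nab raddfD /= row_mul map_row. Qed.

Lemma nab_theta_sym k l : nab k (row l theta) = nab l (row k theta).
Proof.
rewrite !nab_row /nab !der_theta !row_mul; congr (_ *m _).
by apply/rowP => r; rewrite !mxE torsion_free.
Qed.

(** The curvature is the commutator of [nab] on the coordinate fields (rows of [theta]); vanishing
    torsion ([nab_theta_sym]) makes the six second derivatives cancel in pairs. *)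
Lemma bianchi k l r :
  row r theta *m Omega k l + row k theta *m Omega l r + row l theta *m Omega r k = 0.
Proof.
rewrite -!nab_curv (nab_theta_sym l r) (nab_theta_sym r k) (nab_theta_sym k l).
move: (nab k (nab r _)) (nab l (nab k _)) (nab r (nab l _)) => X Y Z.
by rewrite !addrA !subrK subrr.
Qed.

Lemma Omega_anti k l : (Omega k l)^T = - Omega k l.
Proof.
rewrite /Omega; move: (omega_anti k) (omega_anti l).
move: (omega k) (omega l) => ok ol okT olT.
rewrite !linearD /= !linearN /= !map_trmx !trmx_mul okT olT !raddfN /=.
by rewrite !(mulNmx, mulmxN, opprK); mx_ring.
Qed.

Lemma Omega_swap k l : Omega l k = - Omega k l.
Proof. by rewrite /Omega; move: (omega k) (omega l) => ok ol; mx_ring. Qed.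

Lemma gam_up_sum m (X : 'I_n -> 'M[A]_(N, m)) :
  \sum_l gam_up l *m X l = \sum_p g p *m \sum_l E p l *: X l.
Proof.
rewrite /gam_up; under eq_bigr do rewrite mulmx_suml.
rewrite exchange_big; apply: eq_bigr => p _; rewrite mulmx_sumr.
by apply: eq_bigr => l _; rewrite !mxE -scalemxAl -scalemxAr.
Qed.

Lemma E_gam_dn p : \sum_k E p k *: gam_dn k = g p.
Proof.
rewrite -(clif_delta g p) -(mulmx1 (delta_mx 0 p)) -E_theta mulmxA -rowE.
by rewrite clif_mulmx; apply: eq_bigr => k _; rewrite mxE.
Qed.

(** Contracting a coordinate index up and down is the same as summing over the orthonormal frame,
    where the Clifford relations apply directly. *)
Lemma contract_up_down m (X : 'M[A]_N) (s : 'M[A]_(N, m)) :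
  \sum_k gam_up k *m (X *m (gam_dn k *m s)) = \sum_p g p *m (X *m (g p *m s)).
Proof.
rewrite gam_up_sum; apply: eq_bigr => p _; congr (_ *m _).
rewrite -[g p]E_gam_dn mulmx_suml mulmx_sumr; apply: eq_bigr => k _.
by rewrite -scalemxAl -scalemxAr.
Qed.

Definition gcontra : 'M[A]_n := E^T *m E.

Lemma gam_up_anti k l : gam_up k *m gam_up l + gam_up l *m gam_up k = - (2%:R * gcontra k l)%:M.
Proof.
rewrite (clif_anti gC) /gcontra; congr (- scalar_mx (_ * _)).
by rewrite !mxE; apply: eq_bigr => p _; rewrite !mxE.
Qed.

Lemma double_inj (V : lmodType A) (v w : V) : v + v = w + w -> v = w.
Proof.
move=> vw; apply/eqP; rewrite -subr_eq0; apply/eqP/(half_eq0 hE).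
by rewrite addrACA vw -opprD subrr.
Qed.

Lemma gam_up_sym_sum (c : 'I_n -> 'I_n -> A) : (forall k l, c k l = c l k) ->
  \sum_k \sum_l c k l *: (gam_up k *m gam_up l) = - (\sum_k \sum_l c k l * gcontra k l)%:M.
Proof.
move=> csym; apply: double_inj; rewrite {2}exchange_big -big_split /=.
rewrite -opprD -raddfD -big_split /= raddf_sum -sumrN; apply: eq_bigr => k _.
rewrite -!big_split /= raddf_sum -sumrN; apply: eq_bigr => l _ /=.
rewrite (csym l k) -scalerDr gam_up_anti scalerN scale_scalar_mx.
by congr (- scalar_mx _); ring.
Qed.

(** A Clifford product is a wedge product minus an inner product; this links [quad] to the sum over
    p < q by which two-forms act. *)
Lemma quad_split (M : 'M[A]_n) :
  quad g M = \sum_(p < n) \sum_(q < n | (p < q)%N)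
    (M p q - M q p) *: (g p *m g q) - (\tr M)%:M.
Proof.
have split3 p : \sum_q M p q *: (g p *m g q) = - (M p p)%:M +
    (\sum_(q < n | (p < q)%N) M p q *: (g p *m g q)
     + \sum_(q < n | (q < p)%N) M p q *: (g p *m g q)).
  rewrite (bigD1 p) //= (g_sq gC hE) scalerN scalemx1; congr (_ + _).
  rewrite (bigID (fun q : 'I_n => (p < q)%N)) /=; congr (_ + _); apply: eq_bigl => q.
    by rewrite andb_idl // => /gtn_eqF/negbT.
  by rewrite -leqNgt -(inj_eq val_inj) /= ltn_neqAle.
rewrite /quad; under eq_bigr do rewrite split3.
rewrite big_split /= sumrN -raddf_sum addrC; congr (_ - _).
rewrite big_split /=.
under [X in _ + X]eq_bigr do rewrite big_mkcond.
rewrite [X in _ + X]exchange_big -big_split; apply: eq_bigr => p _ /=.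
rewrite -big_mkcond -big_split; apply: eq_bigr => q pq /=.
have /negPf pqF : p != q by rewrite -(inj_eq val_inj) ltn_eqF.
by rewrite (swap_g gC p q) pqF mulr0n subr0 scalerN scalerBl.
Qed.

Lemma curv_contract_scalar : exists c,
  \sum_l gam_up l *m (\sum_k gam_up k *m spinW (Omega l k)) = c%:M.
Proof.
(* The curvature with all indices in the frame, so that [curvature_scalar] applies to it. *)
pose OF p q := \sum_l \sum_k (E p l * E q k) *: Omega l k.
pose R4 p q r s := OF p q r s.
have OF_swap p q : OF q p = - OF p q.
  rewrite /OF exchange_big -sumrN; apply: eq_bigr => l _; rewrite -sumrN.
  by apply: eq_bigr => k _; rewrite Omega_swap scalerN mulrC.
have OF_row p q r : row r (OF p q) =
    \sum_l \sum_k \sum_m (E p l * E q k * E r m) *: (row m theta *m Omega l k).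
  rewrite rowE -[delta_mx 0 r]mulmx1 -E_theta mulmxA -rowE mulmx_sumr.
  apply: eq_bigr => l _; rewrite mulmx_sumr; apply: eq_bigr => k _.
  rewrite -scalemxAr -mulmxA mulmx_sum_row scaler_sumr.
  by apply: eq_bigr => m _; rewrite row_mul scalerA !mxE.
have [p q r s|p q r s|p q r s|c cE] := curvature_scalar gC hE (R4 := R4) tE.
- by rewrite /R4 OF_swap mxE.
- have : (OF p q)^T = - OF p q.
    rewrite /OF linear_sum -sumrN; apply: eq_bigr => l _; rewrite linear_sum -sumrN.
    by apply: eq_bigr => k _; rewrite /= linearZ /= Omega_anti scalerN.
  by move=> /matrixP/(_ r s); rewrite !mxE.
- suff /rowP/(_ s) : row r (OF p q) + row p (OF q r) + row q (OF r p) = 0.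
    by rewrite !mxE.
  rewrite !OF_row [X in _ + X + _]sum_rot [X in _ + X + _]sum_rot [X in _ + X]sum_rot.
  rewrite -!big_split big1 // => l _; rewrite -!big_split big1 // => k _.
  rewrite -!big_split big1 // => m _ /=.
  rewrite (_ : E q k * E r m * E p l = E p l * E q k * E r m); last by ring.
  rewrite (_ : E r m * E p l * E q k = E p l * E q k * E r m); last by ring.
  by rewrite -!scalerDr bianchi scaler0.
exists (h * h * c); rewrite -scale_scalar_mx -cE gam_up_sum scaler_sumr.
apply: eq_bigr => p _; under eq_bigr do rewrite gam_up_sum scaler_sumr.
rewrite exchange_big mulmx_sumr scaler_sumr; apply: eq_bigr => q _.
have -> : \sum_l E p l *: (g q *m \sum_k E q k *: spinW (Omega l k)) = g q *m spinW (OF p q).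
  rewrite raddf_sum mulmx_sumr; apply: eq_bigr => l _; rewrite scalemxAr.
  congr (_ *m _); rewrite scaler_sumr [RHS]raddf_sum; apply: eq_bigr => k _ /=.
  by rewrite spinWZ scalerA.
rewrite /spinW -!scalemxAr !mulmx_sumr; congr (_ *: _); apply: eq_bigr => r _.
rewrite !mulmx_sumr; apply: eq_bigr => s _.
by rewrite -!scalemxAr !mulmxA.
Qed.

(** * The Killing spinor and the Lichnerowicz formula *)

Variable psi : 'cV[A]_N.
Hypothesis killing : forall k, nabS k psi = h *: (gam_dn k *m psi).
Hypothesis psi_unit : psi^T *m psi = 1%:M.

Lemma nabS_scale m k c (s : 'M[A]_(N, m)) : d k c = 0 -> nabS k (c *: s) = c *: nabS k s.
Proof. by move=> c0; rewrite /nabS der_scalemx // c0 scale0r add0r scalerDr scalemxAr. Qed.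

(* The Killing equation determines the spin curvature on psi, and thereby the *)
(* scalar in curv_contract_scalar: 15 is half the scalar curvature.           *)
Lemma killing_curv k l :
  spinW (Omega k l) *m psi =
    (h * h) *: (gam_dn l *m (gam_dn k *m psi) - gam_dn k *m (gam_dn l *m psi)).
Proof.
rewrite -nabS_curv !killing !nabS_scale ?der_half // !nabS_clif -!/(gam_dn _) !killing.
rewrite (nab_theta_sym k l) -scalerBr -scalerA; congr (_ *: _).
by rewrite opprD addrACA subrr add0r -!scalemxAr -scalerBr.
Qed.

Lemma gam_up_dn m (s : 'M[A]_(N, m)) : \sum_k gam_up k *m (gam_dn k *m s) = - 6%:R *: s.
Proof.
have := contract_up_down 1%:M s.
under eq_bigr do rewrite mul1mx; move=> ->.
under eq_bigr do rewrite mul1mx mulmxA (g_sq gC hE) mulNmx mul1mx.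
by rewrite sumr_const card_ord mulNrn scaleNr scaler_nat.
Qed.

Lemma gam_up_clif_dn m v (s : 'M[A]_(N, m)) :
  \sum_k gam_up k *m (clif v *m (gam_dn k *m s)) = 4%:R *: (clif v *m s).
Proof.
rewrite contract_up_down; under eq_bigr do rewrite !mulmxA.
rewrite -mulmx_suml (clif_contract gC hE) -scalemxAl; congr (_ *: _); ring.
Qed.

Lemma half_sq4 : h * h * 4%:R = 1.
Proof.
have -> : h * h * 4%:R = (h + h) * (h + h) by ring.
by rewrite hE mulr1.
Qed.

(** A scalar is determined by its value on the unit spinor [psi]. There, the inner sum gives (- 6 -
    4)/4 times gamma_l psi, and the outer one multiplies by -6. *)
Lemma curv_contract_eq :
  \sum_l gam_up l *m (\sum_k gam_up k *m spinW (Omega l k)) = 15%:R%:M.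
Proof.
have [c cE] := curv_contract_scalar; rewrite cE.
have : c%:M *m psi = 15%:R *: psi.
  rewrite -cE mulmx_suml.
  under eq_bigr do rewrite -mulmxA mulmx_suml.
  under eq_bigr do under eq_bigr do rewrite -mulmxA killing_curv.
  have inner l : \sum_k gam_up k *m ((h * h) *: (gam_dn k *m (gam_dn l *m psi) -
      gam_dn l *m (gam_dn k *m psi))) = (- (h * h * 10%:R)) *: (gam_dn l *m psi).
    under eq_bigr do rewrite -scalemxAr mulmxBr.
    rewrite -scaler_sumr sumrB gam_up_dn gam_up_clif_dn -scalerBl scalerA.
    by congr (_ *: _); ring.
  under eq_bigr do rewrite inner -scalemxAr.
  rewrite -scaler_sumr gam_up_dn scalerA; congr (_ *: _).
  by transitivity (h * h * 4%:R * 15%:R); [ring | rewrite half_sq4 mul1r].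
rewrite mul_scalar_mx => /(congr1 (mulmx psi^T)).
rewrite -!scalemxAr psi_unit !scalemx1 => /matrixP/(_ 0 0).
by rewrite !mxE eqxx !mulr1n => ->.
Qed.

Definition dirac m (s : 'M[A]_(N, m)) := \sum_k gam_up k *m nabS k s.
(* V^k = g^{l r} Gamma^k_{l r}: a first-order term, harmless for the maximum *)
(* principle.                                                                *)
Definition Vf k := \sum_l \sum_r C l r k * gcontra l r.

Lemma nabS_sum m k (I : finType) (F : I -> 'M[A]_(N, m)) :
  nabS k (\sum_i F i) = \sum_i nabS k (F i).
Proof. by rewrite /nabS raddf_sum mulmx_sumr -big_split. Qed.

Lemma clifN v : clif (- v) = - clif v.
Proof. exact: raddfN. Qed.

Lemma nab_ET k l : clif (nab l (row k E^T)) = - \sum_r C l r k *: gam_up r.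
Proof.
rewrite nab_row /nab der_ET linearN /= row_mul clifN clif_mulmx.
by congr (- _); apply: eq_bigr => r _; rewrite !mxE.
Qed.

(** Lichnerowicz's formula, doubled so that 15/2 becomes 15. The derivative of gamma^k produces
    Christoffel symbols symmetric in the contracted indices, hence the term in [Vf]. *)
Lemma dirac_sq m (s : 'M[A]_(N, m)) :
  dirac (dirac s) *+ 2 = (\sum_k Vf k *: nabS k s) *+ 2
    - (\sum_l \sum_k gcontra l k *: nabS l (nabS k s)) *+ 2 + 15%:R *: s.
Proof.
pose T := \sum_l \sum_k gam_up l *m gam_up k *m nabS l (nabS k s).
have -> : dirac (dirac s) = \sum_k Vf k *: nabS k s + T.
  have E1 l : gam_up l *m nabS l (dirac s) =
      \sum_k ((- \sum_r C l r k *: (gam_up l *m gam_up r)) *m nabS k s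
               + gam_up l *m gam_up k *m nabS l (nabS k s)).
    rewrite nabS_sum mulmx_sumr; apply: eq_bigr => k _.
    rewrite nabS_clif mulmxDr nab_ET !mulmxA; congr (_ *m _ + _).
    rewrite mulmxN mulmx_sumr; congr (- _); apply: eq_bigr => r _.
    by rewrite -scalemxAr.
  rewrite {1}/dirac; under eq_bigr do rewrite E1 big_split.
  rewrite big_split; congr (_ + _); rewrite exchange_big; apply: eq_bigr => k _.
  rewrite -mulmx_suml sumrN gam_up_sym_sum ?opprK ?mul_scalar_mx //.
(* Add to T its copy with the two derivatives exchanged: the anticommutator gives the metric, the
   exchange costs the curvature contraction. *)
have T2 : T *+ 2 = - (\sum_l \sum_k gcontra l k *: nabS l (nabS k s)) *+ 2 + 15%:R *: s.
  have E2 : T = \sum_l \sum_k (gam_up k *m gam_up l *m nabS l (nabS k s)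
      + gam_up k *m (gam_up l *m (spinW (Omega k l) *m s))).
    rewrite /T exchange_big; apply: eq_bigr => l _; apply: eq_bigr => k _ /=.
    by rewrite -nabS_curv !mulmxBr !mulmxA addrC subrK.
  rewrite mulr2n {2}E2 -big_split.
  under eq_bigr do rewrite -big_split /=.
  under eq_bigr do under eq_bigr do rewrite addrA -mulmxDl gam_up_anti mulNmx mul_scalar_mx.
  under eq_bigr do rewrite big_split.
  rewrite big_split /=; congr (_ + _).
    rewrite -sumrN -sumrMnl; apply: eq_bigr => l _.
    rewrite -sumrN -sumrMnl; apply: eq_bigr => k _.
    by rewrite -scalerA scaler_nat mulNrn.
  rewrite exchange_big -mul_scalar_mx -curv_contract_eq mulmx_suml; apply: eq_bigr => l _.
  rewrite mulmx_sumr mulmx_suml; apply: eq_bigr => k _.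
  by rewrite !mulmxA.
by rewrite mulrnDl T2 addrA mulNrn.
Qed.

(** * The deformation equations and the Dirac eigenspinor *)

Variable e : 'cV[A]_n.
Hypothesis form_eq : \sum_(p < n) \sum_(q < n | (p < q)%N)
  (E *m (\matrix_(k, l) (d k (e l 0) - d l (e k 0))) *m E^T) p q *: (g p *m g q *m psi) = 0.
Hypothesis div_eq : \sum_j d j (\det theta * (E^T *m E *m e) j 0) = 0.

Definition eta := clif (e^T *m E^T) *m psi.

Lemma clif_tr v : (clif v)^T = - clif v.
Proof.
rewrite /clif linear_sum -sumrN; apply: eq_bigr => p _.
by rewrite /= linearZ /= gT scalerN.
Qed.

Definition nsq := (e^T *m gcontra *m e) 0 0.

Lemma eta_dot : eta^T *m eta = nsq%:M.
Proof.
rewrite /eta trmx_mul clif_tr mulmxN mulNmx -mulmxA [clif _ *m (_ *m _)]mulmxA (clif_sq gC hE).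
rewrite mulNmx mulmxN opprK mul_scalar_mx -scalemxAr psi_unit scalemx1.
by rewrite trmx_mul !trmxK /nsq /gcontra !mulmxA.
Qed.

Definition covder := \matrix_(k, l) (d k (e l 0) - (C k *m e) l 0).

Lemma nab_e k : nab k (e^T *m E^T) = row k covder *m E^T.
Proof.
have -> : row k covder = D k e^T - e^T *m (C k)^T.
  by apply/rowP => l; rewrite -trmx_mul !mxE.
rewrite /nab der_mulmx // -mulmxA mulmxBl -addrA -mulmxDr der_ET mulmxN.
by rewrite mulmxA.
Qed.

(** The divergence of e. The derivative of the volume density [\det theta] is the density times
    Gamma^k_{jk}, so [div_eq] is the density times the covariant divergence. *)
Lemma trace_covder : \tr (E *m covder *m E^T) = 0.
Proof.
have der_det_theta j : d j (\det theta) = \det theta * \tr (C j).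
  have adjE : \adj theta = \det theta *: E.
    rewrite -[LHS]mulmx1 -theta_E mulmxA mul_adj_mx.
    by rewrite mul_scalar_mx.
  rewrite der_det // adjE -scalemxAr mxtraceZ; congr (_ * _).
  have -> : D j theta = C j *m theta - theta *m omega j by rewrite -der_theta addrK.
  rewrite mulmxBl -mulmxA theta_E mulmx1 raddfB /= mxtrace_mulC mulmxA E_theta mul1mx.
  suff -> : \tr (omega j) = 0 by rewrite subr0.
  apply: (half_eq0 hE (V := A^o)).
  by rewrite -[X in X + _]mxtrace_tr omega_anti raddfN /= addNr.
pose b := E^T *m E *m e.
have der_b j : D j b = - ((C j)^T *m b) + E^T *m (nab j (e^T *m E^T))^T.
  rewrite /b -mulmxA der_mulmx //.
  have -> : D j E^T = - ((C j)^T *m E^T) - E^T *m omega j by rewrite -der_ET addrK.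
  rewrite /nab raddfD /= mulmxDr [(_ *m omega j)^T]trmx_mul omega_anti.
  rewrite trmx_mul !trmxK map_trmx trmx_mul !trmxK.
  rewrite mulmxBl !mulNmx mulmxN !mulmxA; mx_ring.
have sumb : \sum_j ((C j)^T *m b) j 0 = \sum_j \tr (C j) * b j 0.
  under eq_bigr do rewrite mxE; rewrite exchange_big; apply: eq_bigr => j _ /=.
  rewrite /mxtrace mulr_suml; apply: eq_bigr => k _.
  by rewrite !mxE torsion_free.
have : \det theta * \tr (E *m covder *m E^T) = 0.
  rewrite -[RHS]div_eq.
  have E1 j : d j (\det theta * b j 0) =
      \det theta * (\tr (C j) * b j 0 - ((C j)^T *m b) j 0
                    + (E^T *m (row j covder *m E^T)^T) j 0).
    rewrite dM der_det_theta -nab_e.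
    have -> : d j (b j 0) = (D j b) j 0 by rewrite [RHS]mxE.
    by rewrite der_b !mxE; ring.
  under [RHS]eq_bigr do rewrite E1.
  rewrite -mulr_sumr; congr (_ * _).
  rewrite [RHS]big_split /= [X in _ = X + _]sumrB sumb subrr add0r.
  rewrite -mulmxA mxtrace_mulC.
  have -> : covder *m E^T *m E = covder *m (E^T *m E) by rewrite mulmxA.
  apply: eq_bigr => j _.
  rewrite trmx_mul trmxK mulmxA mxE [RHS]mxE; apply: eq_bigr => k _.
  rewrite !mxE mulrC; congr (_ * _); apply: eq_bigr => l _; rewrite !mxE; ring.
(* [\det E] is the inverse of [\det theta]. *)
by move=> /(congr1 ( *%R (\det E))); rewrite mulrA -det_mulmx E_theta det1 mul1r mulr0.
Qed.

(** Differentiating psi gives half of the contraction 4 e . psi; differentiating e gives the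
    Clifford action of the tensor nabla e, which the two equations annihilate. *)
Lemma dirac_eta : dirac eta = 2%:R *: eta.
Proof.
rewrite /dirac /eta.
under eq_bigr do rewrite nabS_clif killing -!scalemxAr mulmxDr nab_e -scalemxAr.
rewrite big_split -scaler_sumr gam_up_clif_dn scalerA.
have -> : h * 4%:R = 2%:R.
  have -> : h * 4%:R = (h + h) * 2%:R by ring.
  by rewrite hE mul1r.
rewrite -[RHS]add0r; congr (_ + _); rewrite gam_up_sum.
(* The trace part is the divergence; by vanishing torsion the antisymmetric part is de, which kills
   psi. *)
have Q0 : quad g (E *m covder *m E^T) *m psi = 0.
  rewrite quad_split trace_covder raddf0 subr0 mulmx_suml -[RHS]form_eq.
  apply: eq_bigr => p _; rewrite mulmx_suml; apply: eq_bigr => q _.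
  rewrite -scalemxAl; congr (_ *: _).
  have -> : \matrix_(k, l) (d k (e l 0) - d l (e k 0)) = covder - covder^T.
    apply/matrixP => k l.
    have csym : (C k *m e) l 0 = (C l *m e) k 0.
      by rewrite !mxE; apply: eq_bigr => r _; rewrite torsion_free.
    have -> (X : 'M[A]_n) : (X - X^T) k l = X k l - X l k by rewrite !mxE.
    by rewrite [LHS]mxE [covder k l]mxE [covder l k]mxE csym; ring.
  have -> : E *m (covder - covder^T) *m E^T = E *m covder *m E^T - (E *m covder *m E^T)^T.
    by rewrite !trmx_mul trmxK mulmxBr mulmxBl mulmxA.
  by rewrite !mxE.
rewrite -[RHS]Q0 quad_row mulmx_suml; apply: eq_bigr => p _; rewrite -mulmxA; congr (_ *m _).
rewrite -mulmxA row_mul clif_mulmx mulmx_suml; apply: eq_bigr => k _.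
by rewrite row_mul -scalemxAl mxE.
Qed.

Definition sdot (x y : 'cV[A]_N) := (x^T *m y) 0 0.

Lemma sdotC x y : sdot x y = sdot y x.
Proof. by rewrite /sdot -[x^T *m y]trmxK trmx_mul trmxK mxE. Qed.

Lemma sdotZr c x y : sdot x (c *: y) = c * sdot x y.
Proof. by rewrite /sdot -scalemxAr mxE. Qed.

Lemma sdotDr x y z : sdot x (y + z) = sdot x y + sdot x z.
Proof. by rewrite /sdot mulmxDr mxE. Qed.

Lemma sdot_sumr (I : finType) x (F : I -> 'cV[A]_N) : sdot x (\sum_i F i) = \sum_i sdot x (F i).
Proof. by rewrite /sdot mulmx_sumr summxE. Qed.

Lemma der_sdot k x y : d k (sdot x y) = sdot (nabS k x) y + sdot x (nabS k y).
Proof.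
have /matrixP/(_ 0 0) := nabS_dot k x y.
by rewrite [LHS]mxE [X in _ = X -> _]mxE.
Qed.

Lemma sdot_eta : sdot eta eta = nsq.
Proof. by rewrite /sdot eta_dot mxE. Qed.

Lemma der_nsq k : d k nsq = 2%:R * sdot eta (nabS k eta).
Proof. by rewrite -sdot_eta der_sdot sdotC mulr_natl mulr2n. Qed.

Lemma der2_nsq k l : d k (d l nsq) =
  2%:R * sdot eta (nabS k (nabS l eta)) + 2%:R * sdot (nabS k eta) (nabS l eta).
Proof.
rewrite der_nsq dM der_sdot.
have -> : d k 2%:R = 0 by rewrite mulr2n raddfD /= der1 // addr0.
ring.
Qed.

(** Twice D^2 eta is 8 eta, and 7 = 15 - 8. *)
Lemma sum_hess_eta : (\sum_l \sum_k gcontra l k *: nabS l (nabS k eta)) *+ 2 =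
  (\sum_k Vf k *: nabS k eta) *+ 2 + 7%:R *: eta.
Proof.
have nat0 k j : d k j%:R = 0.
  by elim: j => [|j IH]; rewrite ?raddf0 // mulrS raddfD /= IH der1 ?addr0.
have := dirac_sq eta.
have diracZ (s : 'cV[A]_N) : dirac (2%:R *: s) = 2%:R *: dirac s.
  rewrite /dirac scaler_sumr; apply: eq_bigr => k _.
  by rewrite nabS_scale // scalemxAr.
rewrite dirac_eta diracZ dirac_eta.
move: (\sum_k _) (\sum_l _) => X S H.
apply: (addIr (8%:R *: eta)); rewrite -[RHS]addrA -scalerDl -natrD.
have {1}-> : 8%:R *: eta = X *+ 2 - S *+ 2 + 15%:R *: eta.
  by rewrite -H -[RHS]scaler_nat !scalerA -!natrM.
by move: eta => z; mx_ring.
Qed.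

(** Two derivatives of <eta, eta> yield the Hessian of eta, replaced by [sum_hess_eta], and a
    gradient term that the frame turns into a sum of squares. *)
Theorem weitzenboeck_eq : \sum_k \sum_l gcontra k l * d k (d l nsq) =
  2%:R * (\sum_p sdot (\sum_k E p k *: nabS k eta) (\sum_k E p k *: nabS k eta))
  + \sum_k Vf k * d k nsq + 7%:R * nsq.
Proof.
have -> : \sum_k Vf k * d k nsq = sdot eta ((\sum_k Vf k *: nabS k eta) *+ 2).
  rewrite -scaler_nat sdotZr sdot_sumr mulr_sumr; apply: eq_bigr => k _.
  by rewrite der_nsq sdotZr; ring.
rewrite -[X in 7%:R * X]sdot_eta -sdotZr -addrA -sdotDr -sum_hess_eta.
rewrite -scaler_nat sdotZr -mulrDr sdot_sumr.
under [in LHS]eq_bigr do [under eq_bigr do rewrite der2_nsq -mulrDr mulrCA].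
under [in LHS]eq_bigr do rewrite -mulr_sumr.
rewrite -mulr_sumr; congr (_ * _).
under [in LHS]eq_bigr do [under eq_bigr do rewrite mulrDr].
under [in LHS]eq_bigr do rewrite big_split.
have sdot_suml (I : finType) x (F : I -> 'cV[A]_N) : sdot (\sum_i F i) x = \sum_i sdot (F i) x.
  by rewrite sdotC sdot_sumr; apply: eq_bigr => i _; rewrite sdotC.
rewrite big_split [LHS]addrC /=; congr (_ + _).
  under [RHS]eq_bigr do rewrite sdot_suml.
  rewrite [RHS]exchange_big; apply: eq_bigr => k _.
  under [RHS]eq_bigr do rewrite sdot_sumr.
  rewrite [RHS]exchange_big; apply: eq_bigr => l _.
  rewrite mxE mulr_suml; apply: eq_bigr => p _.
  by rewrite sdotZr [in RHS]sdotC sdotZr sdotC mxE; ring.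
apply: eq_bigr => k _; rewrite sdot_sumr; apply: eq_bigr => l _.
by rewrite sdotZr.
Qed.

End weitzenboeck.

(** * Smooth functions and second derivatives *)

Section local_smoothness.
Variables (R : realType) (V : normedModType R).

Lemma near_eq_differentiable (W : normedModType R) (f g : V -> W) (x : V) :
  (\forall y \near x, f y = g y) -> differentiable f x -> differentiable g x.
Proof.
move=> fg df; have [cdf fE] := (diff_locallyP x f).1 df.
have gxE : g \o shift x = cst (g x) + 'd f x +o_ (0 : V) id.
  apply/eqaddoP => e e0; move/eqaddoP : fE => /(_ e e0).
  have : \forall h \near (0 : V), f (h + x) = g (h + x).
    by move: fg; rewrite (near_shift 0 x) subr0.
  apply: filterS2 => h /= fgh.
  by rewrite !fctE /= fgh (nbhs_singleton fg).
have dE := diff_unique cdf gxE.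
by apply/diff_locallyP; rewrite dE; split.
Qed.

Lemma Ck_on_ext (W : normedModType R) k (U : set V) (f g : V -> W) :
  open U -> (forall x, U x -> f x = g x) -> Ck_on k U f -> Ck_on k U g.
Proof.
move=> oU; elim: k f g => [|k IH] f g fg /=.
  move=> cf x Ux; rewrite /prop_for /continuous_at -fg //.
  apply: cvg_trans (cf x Ux); apply: near_eq_cvg; near=> y; apply: fg.
  by near: y; exact: open_nbhs_nbhs.
have nfg x : U x -> \forall y \near x, f y = g y.
  by move=> Ux; near=> y; apply: fg; near: y; exact: open_nbhs_nbhs.
move=> [df Df]; split=> [x Ux|v].
  exact: near_eq_differentiable (nfg x Ux) (df x Ux).
apply: IH (Df v) => x Ux; apply: near_eq_derive; exact: nfg.
Unshelve. all: by end_near. Qed.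

Lemma Ck_on_sub (W : normedModType R) k (U U' : set V) (f : V -> W) :
  U' `<=` U -> Ck_on k U f -> Ck_on k U' f.
Proof.
move=> UU'; elim: k f => [|k IH] f /=; first by move=> cf x /UU'; exact: cf.
by move=> [df Df]; split=> [x /UU'/df//|v]; exact: IH.
Qed.

Lemma smooth_on_sub (W : normedModType R) (U U' : set V) (f : V -> W) :
  U' `<=` U -> smooth_on U f -> smooth_on U' f.
Proof. by move=> UU' sf k; exact: Ck_on_sub (sf k). Qed.

Lemma smooth_on_ext (W : normedModType R) (U : set V) (f g : V -> W) :
  open U -> (forall x, U x -> f x = g x) -> smooth_on U f -> smooth_on U g.
Proof. by move=> oU fg sf k; exact: Ck_on_ext (sf k). Qed.

Lemma smooth_on_derive (W : normedModType R) (U : set V) (f : V -> W) v :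
  smooth_on U f -> smooth_on U (fun x => 'D_v f x).
Proof. by move=> sf k; have [_] := sf k.+1; apply. Qed.

Lemma smooth_on_differentiable (W : normedModType R) (U : set V) (f : V -> W) x :
  smooth_on U f -> U x -> differentiable f x.
Proof. by move=> sf Ux; have [+ _] := sf 1; apply. Qed.

Lemma Ck_on_cst (W : normedModType R) k (U : set V) (c : W) :
  Ck_on k U (fun _ => c).
Proof.
elim: k c => [|k IH] c /=; first by move=> x _; exact: cst_continuous.
split=> [x _|v]; first exact: differentiable_cst.
have -> : (fun x => 'D_v (fun=> c) x) = fun _ => 0.
  by apply/funext => x; exact: derive_cst.
exact: IH.
Qed.

Lemma Ck_onD (W : normedModType R) k (U : set V) (f g : V -> W) :
  open U -> Ck_on k U f -> Ck_on k U g -> Ck_on k U (fun x => f x + g x).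
Proof.
move=> oU; elim: k f g => [|k IH] f g /=.
  by move=> cf cg x Ux; apply: cvgD; [exact: cf|exact: cg].
move=> [df Df] [dg Dg]; split=> [x Ux|v].
  by apply: differentiableD; [exact: df|exact: dg].
apply: Ck_on_ext (IH _ _ (Df v) (Dg v)) => // x Ux /=.
by rewrite -[RHS]/('D_v (f + g) x) deriveD //; apply: diff_derivable; [exact: df|exact: dg].
Qed.

(** The induction on the order keeps both factors smooth, since the Leibniz rule involves the
    factors and their derivatives. *)
Lemma smooth_onM (U : set V) (f g : V -> R^o) : open U ->
  smooth_on U f -> smooth_on U g -> smooth_on U (fun x => f x * g x : R^o).
Proof.
move=> oU + + k; elim: k f g => [|k IH] f g sf sg.
  by move=> x Ux; apply: cvgM; [exact: (sf 0)|exact: (sg 0)].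
have df x : U x -> differentiable f x by exact: smooth_on_differentiable.
have dg x : U x -> differentiable g x by exact: smooth_on_differentiable.
split=> [x Ux|v].
  by apply: differentiableM; [exact: df|exact: dg].
have H := Ck_onD oU (IH _ _ sf (smooth_on_derive v sg)) (IH _ _ sg (smooth_on_derive v sf)).
apply: Ck_on_ext H => // x Ux /=.
by rewrite -[RHS]/('D_v (f * g) x) deriveM //; apply: diff_derivable; [exact: df|exact: dg].
Qed.

Lemma smooth_onN (U : set V) (f : V -> R^o) : open U ->
  smooth_on U f -> smooth_on U (fun x => - f x : R^o).
Proof.
move=> oU sf; have := smooth_onM oU (fun k => Ck_on_cst k U (- 1 : R^o)) sf.
by apply: smooth_on_ext => // x _; rewrite mulN1r.
Qed.

Lemma smooth_on_entry m n (U : set V) (F : V -> 'M[R]_(m, n)) i j :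
  open U -> smooth_on U F -> smooth_on U (fun x => F x i j : R^o).
Proof.
move=> oU + k; elim: k F => [|k IH] F sF.
  move=> x Ux; apply: (@continuous_comp _ _ _ F (fun N : 'M[R]_(m, n) => N i j)).
    exact: (sF 0).
  exact/differentiable_continuous/differentiable_coord.
have dF x : U x -> differentiable F x by exact: smooth_on_differentiable.
split=> [x Ux|v].
  apply: (@differentiable_comp _ _ _ _ F (fun N : 'M[R]_(m, n) => N i j : R^o)).
    exact: dF.
  exact: differentiable_coord.
apply: Ck_on_ext (IH _ (smooth_on_derive v sF)) => // x Ux /=.
by rewrite derive_mx ?mxE //; apply: diff_derivable; exact: dF.
Qed.

End local_smoothness.

(** * Symmetry of second derivatives and the second derivative test *)

Section second_derivatives.
Variables (R : realType) (V : normedModType R).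
Implicit Types (f : V -> R^o) (x v w : V).

Lemma is_derive_line f x v (s : R) : derivable f (s *: v + x) v ->
  is_derive s (1 : R) (fun r : R => f (r *: v + x) : R^o) ('D_v f (s *: v + x)).
Proof.
move=> df.
have E : (fun h : R => h^-1 *: ((fun r : R => f (r *: v + x)) (h *: (1 : R) + s)
      - f (s *: v + x))) = (fun h : R => h^-1 *: (f (h *: v + (s *: v + x)) - f (s *: v + x))).
  apply/funext => h; congr (_ *: (f _ - _)).
  by rewrite [_%:A]mulr1 scalerDl addrA.
apply: DeriveDef; first by rewrite /derivable E.
by rewrite /derive E.
Qed.

(* Mean value theorem for the difference of f along v at t w + x and at x. *)
Lemma second_difference f x v w : (\forall y \near x, differentiable f y) ->
  differentiable (fun y => 'D_v f y : R^o) x -> forall e : R, 0 < e ->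
  \forall t \near (0:R)^'+,
    `|f (t *: v + (t *: w + x)) - f (t *: v + x) - f (t *: w + x) + f x
      - t ^+ 2 * 'D_w (fun y => 'D_v f y : R^o) x| <= e * t ^+ 2.
Proof.
move=> ndf dDf e e0.
(* The increments a v + b w with 0 <= a, b <= t have norm at most t M, and the 1 makes M positive;
   the tolerance e / (2 M) splits e between two error terms. *)
pose M : R := `|v| + `|w| + 1.
have M0 : 0 < M by rewrite /M ltr_wpDl // addr_ge0.
pose L := 'd (fun y => 'D_v f y : R^o) x.
have e'0 : 0 < e / (2 * M) by rewrite divr_gt0 // mulr_gt0.
have [_ /eqaddoP/(_ _ e'0) Lo] := (diff_locallyP x (fun y => 'D_v f y : R^o)).1 dDf.
have ndf0 : \forall h \near (0 : V), differentiable f (h + x).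
  by move: ndf; rewrite (near_shift 0 x) subr0.
have [d /= d0 dP] := (nbhs_ballP (0 : V) _).1 (filterI Lo ndf0).
have {dP} dP h : `|h| < d ->
    `|'D_v f (h + x) - 'D_v f x - L h| <= e / (2 * M) * `|h| /\ differentiable f (h + x).
  move=> hd; have [] := dP h; rewrite -?ball_normE /ball_ /= ?sub0r ?normrN //.
  by rewrite opprD addrA.
near=> t.
have t0 : 0 < t by near: t; exact: nbhs_right_gt.
have td : t * M < d.
  by rewrite -ltr_pdivlMr //; near: t; apply: nbhs_right_lt; rewrite divr_gt0.
have small (a b : R) : 0 <= a <= t -> 0 <= b <= t -> `|a *: v + b *: w| <= t * M.
  move=> /andP[a0 at_] /andP[b0 bt]; rewrite (le_trans (ler_normD _ _)) // !normrZ !ger0_norm //.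
  have := ler_wpM2r (normr_ge0 v) at_; have := ler_wpM2r (normr_ge0 w) bt.
  by rewrite /M; nra.
have small_lt (a b : R) : 0 <= a <= t -> 0 <= b <= t -> `|a *: v + b *: w| < d.
  by move=> ha hb; exact: le_lt_trans (small a b ha hb) td.
have t0t : 0 <= t <= t by rewrite lexx ltW.
have z0t : 0 <= (0 : R) <= t by rewrite lexx ltW.
pose phi (r : R) : R^o := f (r *: v + (t *: w + x)) - f (r *: v + x).
have dphi r : 0 <= r <= t ->
    is_derive r (1 : R) phi ('D_v f (r *: v + (t *: w + x)) - 'D_v f (r *: v + x)).
  move=> hr; apply: is_deriveB; apply: is_derive_line; apply: diff_derivable.
    by rewrite addrA; apply: (dP _ (small_lt _ _ hr t0t)).2.
  by have := (dP _ (small_lt _ _ hr z0t)).2; rewrite scale0r addr0.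
have [||c ct] := @MVT R phi (fun r => 'D_v f (r *: v + (t *: w + x)) - 'D_v f (r *: v + x)) 0 t t0.
- by move=> r /itvP rt; apply: dphi; rewrite !rt.
- apply: derivable_within_continuous => r /itvP rt.
  have hr : 0 <= r <= t by rewrite !rt.
  exact: (@ex_derive _ _ _ _ _ _ _ (dphi r hr)).
rewrite subr0 {1 2}/phi !scale0r !add0r => phiE.
have ct' : 0 <= c <= t by rewrite !(itvP ct).
have [H1 _] := dP _ (small_lt _ _ ct' t0t).
have [H2 _] := dP _ (small_lt _ _ ct' z0t).
have L1 : L (c *: v + t *: w) = c * L v + t * L w by rewrite linearD !linearZ.
have L2 : L (c *: v + 0 *: w) = c * L v by rewrite scale0r addr0 linearZ.
rewrite L1 -(addrA (c *: v)) in H1.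
rewrite L2 scale0r addr0 in H2.
have -> : f (t *: v + (t *: w + x)) - f (t *: v + x) - f (t *: w + x) + f x =
    f (t *: v + (t *: w + x)) - f (t *: v + x) - (f (t *: w + x) - f x).
  by ring.
have bnd (y : V) : `|y| <= t * M -> e / (2 * M) * `|y| <= e * t / 2.
  move=> yM; have -> : e * t / 2 = e / (2 * M) * (t * M).
    by field; rewrite gt_eqF.
  by rewrite ler_pM2l.
have {}H1 := le_trans H1 (bnd _ (small _ _ ct' t0t)).
have c0v : `|c *: v| <= t * M by have := small _ _ ct' z0t; rewrite scale0r addr0.
have {}H2 := le_trans H2 (bnd _ c0v).
rewrite phiE (deriveE _ dDf) -/L.
have -> : ('D_v f (c *: v + (t *: w + x)) - 'D_v f (c *: v + x)) * t - t ^+ 2 * L w =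
   t * (('D_v f (c *: v + (t *: w + x)) - 'D_v f x - (c * L v + t * L w))
    - ('D_v f (c *: v + x) - 'D_v f x - c * L v)) by ring.
rewrite normrM (gtr0_norm t0) expr2 mulrCA ler_pM2l //.
rewrite (le_trans (ler_normB _ _)) // (le_trans (lerD H1 H2)) //.
by rewrite -splitr.
Unshelve. all: by end_near. Qed.

(** The second difference is symmetric in v and w, and to order t^2 it is t^2 times either mixed
    derivative. *)
Lemma derive_comm f x v w : (\forall y \near x, differentiable f y) ->
  (forall u, differentiable (fun y => 'D_u f y : R^o) x) ->
  'D_v (fun y => 'D_w f y : R^o) x = 'D_w (fun y => 'D_v f y : R^o) x.
Proof.
move=> ndf dDf; set a := LHS; set b := RHS.
apply/eqP; rewrite -subr_eq0 -normr_le0; apply/ler_addgt0Pr => e e0; rewrite add0r.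
have e2 : 0 < e / 2 by rewrite divr_gt0.
have [t [[H1 H2] t0]] := filter_ex (filterI (filterI
  (second_difference v ndf (dDf w) e2) (second_difference w ndf (dDf v) e2))
  (nbhs_right_gt (0 : R))).
move: H1 H2; set A := f (t *: v + (t *: w + x)).
rewrite (addrCA (t *: w)) -/A -/a -/b.
move: (f x) (f (t *: w + x)) (f (t *: v + x)) @A @a @b => z B C A a b H1 H2.
have := le_trans (ler_normB _ _) (lerD H2 H1).
have -> : A - C - B + z - t ^+ 2 * b - (A - B - C + z - t ^+ 2 * a) =
  t ^+ 2 * (a - b) by ring.
rewrite normrM ger0_norm ?sqr_ge0 // -mulrDl -splitr mulrC ler_pM2r //.
by rewrite exprn_gt0.
Qed.

Lemma near_line (P : V -> Prop) x v : (\forall y \near x, P y) ->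
  exists2 r : R, 0 < r & forall s : R, `|s| < r -> P (s *: v + x).
Proof.
move=> nP; have nP0 : \forall h \near (0 : V), P (h + x).
  by move: nP; rewrite (near_shift 0 x) subr0.
have [d /= d0 dP] := (nbhs_ballP (0 : V) _).1 nP0.
have v0 : 0 < `|v| + 1 by rewrite ltr_wpDl.
exists (d / (`|v| + 1)); first by rewrite divr_gt0.
move=> s; rewrite ltr_pdivlMr // => sd; apply: dP.
rewrite -ball_normE /ball_ /= sub0r normrN normrZ (le_lt_trans _ sd) //.
by rewrite ler_wpM2l // lerDl.
Qed.

Lemma derive_at_max f x v : (\forall y \near x, f y <= f x) ->
  (\forall y \near x, differentiable f y) -> 'D_v f x = 0.
Proof.
move=> maxf ndf; have [r r0 rP] := near_line v (filterI maxf ndf).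
have rN : - r <= r by rewrite (le_trans _ (ltW r0)) // oppr_le0 ltW.
have := @derive1_at_max R (fun s => f (s *: v + x)) (- r) r 0 rN.
have df s : `|s| < r -> derivable f (s *: v + x) v.
  by move=> /rP[_] /diff_derivable; exact.
case.
- move=> s; rewrite in_itv /= -ltr_norml => /df/is_derive_line D.
  exact: (@ex_derive _ _ _ _ _ _ _ D).
- by rewrite in_itv /= oppr_lt0 r0.
- move=> s; rewrite in_itv /= -ltr_norml => /rP[+ _].
  by rewrite scale0r add0r.
move=> _; have D := is_derive_line (df 0 _).
move=> <-.
have /D {}D : `|0 : R| < r by rewrite normr0.
by rewrite (@derive_val _ _ _ _ _ _ _ D) scale0r add0r.
Qed.

Lemma derive2_at_max f x v : (\forall y \near x, f y <= f x) ->
  (\forall y \near x, differentiable f y) ->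
  differentiable (fun y => 'D_v f y : R^o) x ->
  'D_v (fun y => 'D_v f y : R^o) x <= 0.
Proof.
move=> maxf ndf dDf; apply/ler_addgt0Pr => e e0; rewrite add0r.
have [r r0 rP] := near_line v maxf.
(* The second difference along v and - v is nonnegative at a maximum. *)
have [t [[H t0] tr]] := filter_ex (filterI (filterI (second_difference (- v) ndf dDf e0)
  (nbhs_right_gt (0 : R))) (nbhs_right_lt r0)).
move: H; rewrite addrA -scalerDr subrr scaler0 add0r !deriveE // linearN.
set c := 'd _ _ v.
have := rP t; rewrite gtr0_norm // => /(_ tr) fv.
have := rP (- t); rewrite normrN gtr0_norm // => /(_ tr).
rewrite scaleNr -scalerN => fNv.
rewrite ler_norml => /andP[_].
have t2 : 0 < t ^+ 2 by rewrite exprn_gt0.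
move=> H; rewrite -(ler_pM2r t2); move: H fv fNv => /=.
move: (f _) (f (t *: - v + x)) (f x) (t ^+ 2) => A B C D; rewrite /=; lra.
Qed.

End second_derivatives.

(** * The differential ring of smooth functions on an open set *)

Record opens (T : topologicalType) := Opens { oset :> set T; osetP : open oset }.

Section smooth_functions.
Variables (R : realType) (V : normedModType R) (O : opens V).
Notation U := (oset O).
Notation pt := {x : V | U x}.

(* Smooth functions are represented on the subtype of points of the open set, *)
(* so that functions agreeing on it are equal and form a subring.             *)
Definition ext0 (f : pt -> R) : V -> R^o := fun x =>
  if pselect (U x) is left Ux then f (exist _ x Ux) else 0.

Lemma ext0E f (p : pt) : ext0 f (sval p) = f p.
Proof.
rewrite /ext0; case: pselect => [Ux|]; last by case: p.
by case: p Ux => x Ux Ux' /=; congr (f (exist _ _ _)); exact: Prop_irrelevance.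
Qed.

Definition smooth_pred : pred (pt -> R) := fun f => `[< smooth_on U (ext0 f) >].

Lemma smooth_ext0 (F : V -> R^o) (f : pt -> R) :
  (forall p, F (sval p) = f p) -> smooth_on U F -> smooth_on U (ext0 f).
Proof.
move=> Ff sF; apply: smooth_on_ext sF; first exact: osetP.
by move=> x Ux; rewrite -[x]/(sval (exist _ x Ux : pt)) ext0E.
Qed.

Lemma smooth_pred_subring : subring_closed smooth_pred.
Proof.
have oU : open U := osetP O.
split=> [|f g|f g]; rewrite !inE.
- by apply: (smooth_ext0 (F := fun=> 1)) => // k; exact: Ck_on_cst.
- move=> sf sg; apply: (smooth_ext0 (F := fun x => ext0 f x - ext0 g x)).
    by move=> p; rewrite !ext0E.
  by move=> k; apply: Ck_onD (sf k) _ => //; exact: smooth_onN.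
- move=> sf sg; apply: (smooth_ext0 (F := fun x => ext0 f x * ext0 g x)).
    by move=> p; rewrite !ext0E.
  exact: smooth_onM.
Qed.

Record smooth_fct := SmoothFct { sfun : pt -> R; _ : sfun \in smooth_pred }.
HB.instance Definition _ := [isSub for sfun].
HB.instance Definition _ := [Choice of smooth_fct by <:].
HB.instance Definition _ := GRing.SubChoice_isSubComPzRing.Build (pt -> R) smooth_pred
  smooth_fct smooth_pred_subring.

Definition evalf (p : pt) (a : smooth_fct) : R := sfun a p.

Fact evalf_is_zmod_morphism p : zmod_morphism (evalf p).
Proof. by move=> a b; rewrite /evalf -[sfun _]/(val _) raddfB. Qed.
HB.instance Definition _ p :=
  GRing.isZmodMorphism.Build smooth_fct R (evalf p) (evalf_is_zmod_morphism p).

Fact evalf_is_monoid_morphism p : monoid_morphism (evalf p).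
Proof.
split; first by rewrite /evalf -[sfun _]/(val _) rmorph1.
by move=> a b; rewrite /evalf -[sfun _]/(val _) rmorphM.
Qed.
HB.instance Definition _ p :=
  GRing.isMonoidMorphism.Build smooth_fct R (evalf p) (evalf_is_monoid_morphism p).

Lemma evalfM p a b : evalf p (a * b) = evalf p a * evalf p b.
Proof. exact: rmorphM. Qed.

Lemma evalfD p a b : evalf p (a + b) = evalf p a + evalf p b.
Proof. exact: rmorphD. Qed.

Lemma evalfB p a b : evalf p (a - b) = evalf p a - evalf p b.
Proof. exact: rmorphB. Qed.

Lemma evalf_sum p (I : Type) (r : seq I) (Q : pred I) (F : I -> smooth_fct) :
  evalf p (\sum_(j <- r | Q j) F j) = \sum_(j <- r | Q j) evalf p (F j).
Proof. exact: rmorph_sum. Qed.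

Lemma eq_evalf (a b : smooth_fct) : (forall p, evalf p a = evalf p b) -> a = b.
Proof. by move=> ab; apply/val_inj/funext => p; exact: ab. Qed.

Definition mkfun (F : V -> R^o) (sF : smooth_on U F) : smooth_fct :=
  SmoothFct (asboolT (smooth_ext0 (fun=> erefl) sF)).

Lemma evalf_mkfun F sF p : evalf p (@mkfun F sF) = F (sval p).
Proof. by []. Qed.

Lemma smooth_val (a : smooth_fct) : smooth_on U (ext0 (sfun a)).
Proof. by apply/asboolP; case: a. Qed.

Definition dirder (v : V) (a : smooth_fct) : smooth_fct :=
  mkfun (smooth_on_derive v (smooth_val a)).

Lemma near_sval (p : pt) (P : V -> Prop) : (forall q : pt, P (sval q)) ->
  \forall y \near sval p, P y.
Proof.
move=> UP; near=> y.
have Uy : U y by near: y; apply: open_nbhs_nbhs; split; [exact: osetP|case: p].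
exact: (UP (exist _ y Uy)).
Unshelve. all: by end_near. Qed.

(** [U] is open, so the derivative sees only values on [U] and any [F] agreeing with [a] there
    computes it. *)
Lemma evalf_dirder v a (F : V -> R^o) p : (forall q, evalf q a = F (sval q)) ->
  evalf p (dirder v a) = 'D_v F (sval p).
Proof.
move=> aF; rewrite evalf_mkfun; apply: near_eq_derive.
by apply: near_sval => q; rewrite ext0E; exact: aF.
Qed.

Lemma diff_ext0 (a : smooth_fct) (p : pt) : differentiable (ext0 (sfun a)) (sval p).
Proof. by apply: smooth_on_differentiable (smooth_val a) _; case: p. Qed.

Fact dirder_is_zmod_morphism v : zmod_morphism (dirder v).
Proof.
move=> a b; apply: eq_evalf => p; rewrite [RHS]raddfB.
rewrite (@evalf_dirder v (a - b) (ext0 (sfun a) - ext0 (sfun b))); last first.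
  by move=> q; rewrite raddfB !fctE !ext0E.
by rewrite deriveB //; apply: diff_derivable; exact: diff_ext0.
Qed.
HB.instance Definition _ v :=
  GRing.isZmodMorphism.Build smooth_fct smooth_fct (dirder v) (dirder_is_zmod_morphism v).

Lemma dirder_bigsum v (I : finType) (F : I -> smooth_fct) :
  dirder v (\sum_j F j) = \sum_j dirder v (F j).
Proof. exact: raddf_sum. Qed.

Lemma dirderM v a b : dirder v (a * b) = dirder v a * b + a * dirder v b.
Proof.
apply: eq_evalf => p; rewrite [RHS]rmorphD !rmorphM.
rewrite (@evalf_dirder v (a * b) (ext0 (sfun a) * ext0 (sfun b))); last first.
  by move=> q; rewrite rmorphM !fctE !ext0E.
rewrite deriveM; try by apply: diff_derivable; exact: diff_ext0.
by rewrite !ext0E addrC [_ *: _]mulrC.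
Qed.

Lemma dirder_comm v w a : dirder v (dirder w a) = dirder w (dirder v a).
Proof.
apply: eq_evalf => p.
have E1 v' w' : evalf p (dirder v' (dirder w' a)) =
    'D_v' (fun x => 'D_w' (ext0 (sfun a)) x : R^o) (sval p).
  by apply: evalf_dirder => q; rewrite evalf_mkfun.
rewrite E1 E1.
apply: derive_comm; first by apply: near_sval => q; exact: diff_ext0.
move=> u; apply: smooth_on_differentiable (smooth_on_derive u (smooth_val a)) _.
exact: svalP.
Qed.

Definition constf (c : R) : smooth_fct := mkfun (fun k => Ck_on_cst k U (c : R^o)).

Lemma evalf_constf c p : evalf p (constf c) = c.
Proof. by []. Qed.

Lemma evalf_dirderE v a p : evalf p (dirder v a) = 'd (ext0 (sfun a)) (sval p) v.
Proof. by rewrite evalf_mkfun deriveE //; exact: diff_ext0. Qed.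

Lemma dirder_const v c : dirder v (constf c) = 0.
Proof.
apply: eq_evalf => p; rewrite raddf0 -[RHS](derive_cst (c : R^o) (sval p) v).
by apply: evalf_dirder => q; rewrite evalf_mkfun.
Qed.

Section matrices.
Variables (m n : nat).

Definition mkmx (F : V -> 'M[R]_(m, n)) (sF : smooth_on U F) : 'M[smooth_fct]_(m, n) :=
  \matrix_(i, j) mkfun (smooth_on_entry i j (osetP O) sF).

Definition evalmx (p : pt) (A : 'M[smooth_fct]_(m, n)) : 'M[R]_(m, n) := map_mx (evalf p) A.

Lemma evalmx_mkmx F sF p : evalmx p (@mkmx F sF) = F (sval p).
Proof. by apply/matrixP => i j; rewrite !mxE. Qed.

Lemma eq_evalmx (A B : 'M[smooth_fct]_(m, n)) : (forall p, evalmx p A = evalmx p B) -> A = B.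
Proof.
move=> AB; apply/matrixP => i j; apply: eq_evalf => p.
by have /matrixP/(_ i j) := AB p; rewrite !mxE.
Qed.

Lemma evalmx_dirder v (A : 'M[smooth_fct]_(m, n)) (F : V -> 'M[R]_(m, n)) p :
  (forall q, evalmx q A = F (sval q)) -> evalmx p (map_mx (dirder v) A) = 'D_v F (sval p).
Proof.
move=> AF; have AFij i j q : evalf q (A i j) = F (sval q) i j by rewrite -AF mxE.
rewrite derive_mx; last first.
  apply/derivable_mxP => i j; apply: (@near_eq_derivable _ _ _ (ext0 (sfun (A i j)))
    (fun x => F x i j : R^o)).
    by apply: near_sval => q; rewrite ext0E; exact: AFij.
  exact: diff_derivable (diff_ext0 (A i j) p).
by apply/matrixP => i j; rewrite !mxE; apply: evalf_dirder => q; exact: AFij.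
Qed.

Lemma evalmxE p (A : 'M[smooth_fct]_(m, n)) i j : evalmx p A i j = evalf p (A i j).
Proof. by rewrite mxE. Qed.

Lemma evalmxD p (A B : 'M[smooth_fct]_(m, n)) : evalmx p (A + B) = evalmx p A + evalmx p B.
Proof. exact: map_mxD. Qed.

Lemma evalmxZ p (x : smooth_fct) (A : 'M[smooth_fct]_(m, n)) :
  evalmx p (x *: A) = evalf p x *: evalmx p A.
Proof. exact: map_mxZ. Qed.

End matrices.

Lemma evalmxM p m n q (A : 'M[smooth_fct]_(m, n)) (B : 'M[smooth_fct]_(n, q)) :
  evalmx p (A *m B) = evalmx p A *m evalmx p B.
Proof. exact: map_mxM. Qed.

Lemma evalmx_tr p m n (A : 'M[smooth_fct]_(m, n)) : evalmx p A^T = (evalmx p A)^T.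
Proof. by rewrite /evalmx map_trmx. Qed.

Lemma evalmx1 p n : evalmx p (1%:M : 'M[smooth_fct]_n) = 1%:M.
Proof. exact: map_mx1. Qed.

End smooth_functions.

Arguments evalf : simpl never.
Arguments dirder : simpl never.
Arguments mkfun : simpl never.
Arguments constf : simpl never.

(** * The maximum principle in a chart *)

Section levi_civita.
Variables (A : comPzRingType) (n : nat) (d : 'I_n -> {additive A -> A}) (h : A).
Hypothesis hE : h + h = 1.
Variables (G E : 'M[A]_n).
Hypotheses (GT : G^T = G) (EGE : E *m G *m E^T = 1%:M).

(** [E^T *m E] serves as the inverse metric and [h] as 1/2, so nothing has to be inverted in the
    ring. *)
Definition chris (k : 'I_n) : 'M[A]_n := \matrix_(r, l)
  (h * \sum_s (E^T *m E) l s * (d k (G s r) + d r (G s k) - d s (G k r))).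

Let Gsym r s : G r s = G s r. Proof. by rewrite -[in LHS]GT mxE. Qed.

Lemma chris_torsion_free k r l : chris k r l = chris r k l.
Proof.
rewrite !mxE; congr (_ * _); apply: eq_bigr => s _; congr (_ * _).
by rewrite (Gsym k r) [d k _ + _]addrC.
Qed.

Lemma mulG_EtE : G *m (E^T *m E) = 1%:M.
Proof. by rewrite mulmxA; apply: mulmx1C; rewrite mulmxA. Qed.

Lemma chris_metric k : chris k *m G + (chris k *m G)^T = map_mx (d k) G.
Proof.
have CG r s : (chris k *m G) r s = h * (d k (G s r) + d r (G s k) - d s (G k r)).
  rewrite mxE; under eq_bigr do rewrite mxE -mulrA mulr_suml.
  rewrite -mulr_sumr exchange_big /=; congr (h * _).
  rewrite -[RHS](sumr_pick (fun t => d k (G t r) + d r (G t k) - d t (G k r)) s).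
  apply: eq_bigr => t _.
  have /matrixP/(_ s t) := mulG_EtE; rewrite mxE [RHS]mxE => GEE.
  rewrite -mulr_natl -GEE mulr_suml; apply: eq_bigr => l _.
  by rewrite (Gsym l s); ring.
apply/matrixP => r s; rewrite [LHS]mxE [X in _ + X]mxE !CG [RHS]mxE.
rewrite (Gsym s r) (Gsym k r) (Gsym s k) -mulrDr.
transitivity (h * (d k (G r s) + d k (G r s))); first by congr (_ * _); ring.
by rewrite mulrDr -mulrDl hE mul1r.
Qed.
End levi_civita.

Section dirder_linear.
Variables (R : realType) (n : nat) (O : opens 'rV[R]_n).
Notation A := (smooth_fct O).
Notation dd k := (dirder (delta_mx 0 k : 'rV[R]_n)).

Lemma dirder_sum (v : 'rV[R]_n) (a : A) :
  dirder v a = \sum_k constf O (v 0 k) * dd k a.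
Proof.
apply: eq_evalf => p; rewrite rmorph_sum.
under eq_bigr do rewrite rmorphM /= evalf_constf evalf_dirderE.
rewrite evalf_dirderE {1}[v]row_sum_delta linear_sum.
by apply: eq_bigr => k _; rewrite linearZ.
Qed.

Lemma dirder2_sum (v : 'rV[R]_n) (a : A) :
  dirder v (dirder v a) = \sum_k \sum_l constf O (v 0 k * v 0 l) * dd k (dd l a).
Proof.
rewrite dirder_sum; apply: eq_bigr => k _.
rewrite (dirder_sum v a) raddf_sum mulr_sumr; apply: eq_bigr => l _ /=.
rewrite dirderM dirder_const mul0r add0r mulrA; congr (_ * _).
by apply: eq_evalf => p; rewrite rmorphM.
Qed.

End dirder_linear.

Section local_vanishing.
Variables (R : realType) (gm : clifford_model R) (O : opens 'rV[R]_6).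
Notation A := (smooth_fct O).
Notation pt := {x : 'rV[R]_6 | oset O x}.
Definition pder (k : 'I_6) : {additive A -> A} := dirder (delta_mx 0 k : 'rV[R]_6).
Definition gammaA (p : 'I_6) : 'M[A]_8 := map_mx (constf O) (gm p).
Notation half := (constf O 2^-1).
Variables (G E : 'M[A]_6) (psi : 'cV[A]_8) (e : 'cV[A]_6).
Hypotheses (GT : G^T = G) (EGE : E *m G *m E^T = 1%:M).
Notation C := (chris pder half G E).
Hypothesis killing : forall k,
  nabS pder half gammaA G E C k psi = half *: (gam_dn gammaA G E k *m psi).
Hypothesis psi_unit : psi^T *m psi = 1%:M.
Hypothesis form_eq : \sum_(p < 6) \sum_(q < 6 | (p < q)%N)
  (E *m (\matrix_(k, l) (pder k (e l 0) - pder l (e k 0))) *m E^T) p q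
    *: (gammaA p *m gammaA q *m psi) = 0.
Hypothesis div_eq : \sum_j pder j (\det (theta G E) * (E^T *m E *m e) j 0) = 0.

Lemma constf_rmorph : exists c : {rmorphism R -> A}, forall x, c x = constf O x.
Proof.
have cz : zmod_morphism (constf O) by move=> x y; apply: eq_evalf => p; rewrite raddfB.
have cm : monoid_morphism (constf O).
  split; first by apply: eq_evalf => p; rewrite rmorph1.
  by move=> x y; apply: eq_evalf => p; rewrite rmorphM.
pose c1 := GRing.isZmodMorphism.Build R A (constf O) cz.
pose c2 := GRing.isMonoidMorphism.Build R A (constf O) cm.
by exists (HB.pack (constf O) c1 c2 : {rmorphism R -> A}).
Qed.

(** In [weitzenboeck_eq] at a maximum, the left side is nonpositive, the first-order terms vanish
    and the gradient term is nonnegative, which leaves 7 |e|^2 <= 0. *)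
Lemma local_vanishing (p0 : pt) :
  (forall q : pt, evalf q (nsq E e) <= evalf p0 (nsq E e)) -> evalf p0 (nsq E e) <= 0.
Proof.
move=> umax.
have [c cE] := constf_rmorph.
have cmx m n (X : 'M[R]_(m, n)) : map_mx (constf O) X = map_mx c X.
  by apply/matrixP => i j; rewrite !mxE cE.
have hE : half + half = 1.
  by rewrite -!cE -rmorphD -(rmorph1 c); congr (c _); lra.
have tE : constf O 3^-1 *+ 3 = 1.
  by rewrite -!cE -rmorphMn -(rmorph1 c); congr (c _); rewrite -mulr_natr mulVf.
have gC p q : gammaA p *m gammaA q + gammaA q *m gammaA p = (- 2%:R *+ (p == q))%:M.
  rewrite /gammaA !cmx -!map_mxM -map_mxD gam_clifford map_scalar_mx.
  by rewrite rmorphMn rmorphN rmorph_nat mulNrn.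
have gT p : (gammaA p)^T = - gammaA p by rewrite /gammaA map_trmx gam_skew cmx map_mxN -cmx.
have gD k p : map_mx (pder k) (gammaA p) = 0.
  by apply/matrixP => i j; rewrite !mxE; exact: dirder_const.
have W := weitzenboeck_eq (fun k => @dirderM _ _ _ _) (fun k l => @dirder_comm _ _ _ _ _)
  hE tE gC gT gD GT EGE (chris_torsion_free pder half E GT) (chris_metric pder hE GT EGE)
  killing psi_unit form_eq div_eq.
pose w := ext0 (sfun (nsq E e)).
have maxw : \forall y \near sval p0, w y <= w (sval p0).
  by apply: near_sval => q; rewrite /w !ext0E; exact: umax.
have dw : \forall y \near sval p0, differentiable w y.
  by apply: near_sval => q; exact: diff_ext0.
have der0 v : evalf p0 (dirder v (nsq E e)) = 0.
  exact: (derive_at_max v maxw dw).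
have der2 v : evalf p0 (dirder v (dirder v (nsq E e))) <= 0.
  rewrite (@evalf_dirder _ _ _ v _ (fun x => 'D_v w x : R^o)); last first.
    by move=> q; rewrite evalf_mkfun.
  apply: (derive2_at_max maxw dw).
  by apply: smooth_on_differentiable (smooth_on_derive v (smooth_val _)) _; exact: svalP.
have lhs_le0 : evalf p0 (\sum_k \sum_l gcontra E k l * pder k (pder l (nsq E e))) <= 0.
  (* Since g^{kl} = sum_p E_pk E_pl, freezing the frame vectors at [p0] turns the contracted Hessian
     into a sum of pure second derivatives. *)
  have -> : evalf p0 (\sum_k \sum_l gcontra E k l * pder k (pder l (nsq E e))) =
      \sum_p evalf p0 (dirder (\row_k evalf p0 (E p k))
        (dirder (\row_k evalf p0 (E p k)) (nsq E e))).
    under [RHS]eq_bigr do rewrite dirder2_sum rmorph_sum.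
    rewrite rmorph_sum [RHS]exchange_big; apply: eq_bigr => k _.
    under [RHS]eq_bigr do rewrite rmorph_sum.
    rewrite rmorph_sum [RHS]exchange_big; apply: eq_bigr => l _.
    rewrite rmorphM /= mxE rmorph_sum mulr_suml; apply: eq_bigr => p _.
    by rewrite [RHS]rmorphM /= evalf_constf rmorphM !mxE.
  by apply: sumr_le0 => p _; exact: der2.
have sdot_ge0 (x : 'cV[A]_8) : 0 <= evalf p0 (sdot x x).
  rewrite /sdot mxE rmorph_sum; apply: sumr_ge0 => i _.
  by rewrite mxE rmorphM /= -expr2 sqr_ge0.
move: lhs_le0; rewrite W !rmorphD !rmorphM !rmorph_nat !rmorph_sum /=.
rewrite [X in _ + X + _]big1 ?addr0; last by move=> k _; rewrite rmorphM /= der0 mulr0.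
have : 0 <= \sum_p evalf p0 (sdot
   (\sum_k E p k *: nabS pder half gammaA G E C k (eta gammaA E psi e))
   (\sum_k E p k *: nabS pder half gammaA G E C k (eta gammaA E psi e))).
  by apply: sumr_ge0 => p _; exact: sdot_ge0.
rewrite /pder; move: (\sum_p _) => X; lra.
Qed.
End local_vanishing.

(** * Clifford operators under ring morphisms, for evaluation at a point *)

Section morphisms.
Variables (A B : comPzRingType) (f : {rmorphism A -> B}) (n N : nat).
Variables (g : 'I_n -> 'M[A]_N).
Notation fg := (fun p => map_mx f (g p)).

Lemma map_clif v : map_mx f (clif g v) = clif fg (map_mx f v).
Proof.
rewrite /clif raddf_sum; apply: eq_bigr => p _ /=.
by rewrite map_mxZ !mxE.
Qed.

Lemma map_spinW h omega : map_mx f (spinW g h omega) = spinW fg (f h) (map_mx f omega).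
Proof.
rewrite /spinW map_mxZ rmorphM; congr (_ *: _).
rewrite /quad raddf_sum; apply: eq_bigr => p _ /=.
rewrite raddf_sum; apply: eq_bigr => q _ /=.
by rewrite map_mxZ map_mxM !mxE.
Qed.
End morphisms.

(** * Abelian structure groups: the covariant exterior derivative is the ordinary one *)

Section abelian.
Variables (R : realType) (m : nat) (K : lie_group R m).
Hypothesis hK : lg_abelian K.

Lemma open_coord_image n (M : manifold R n) (i : chart M) (W : set M) : open W ->
  open (coord i @` (dom i `&` W)).
Proof.
move=> oW; rewrite openE => _ [x [ix Wx] <-]; rewrite /interior.
have nW : \forall y \near coord i x, W (par i y).
  have := @par_continuous _ _ M i x ix; rewrite /prop_for /continuous_at coordK // => /(_ W).
  by apply; apply: open_nbhs_nbhs; split.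
have nD : \forall y \near coord i x, (coord i @` dom i) y.
  by apply: open_nbhs_nbhs; split; [exact: coord_open|exists x].
near=> y; have [z iz zy] : (coord i @` dom i) y by near: y.
exists z => //; split=> //.
have : W (par i y) by near: y.
by rewrite -zy coordK.
Unshelve. all: by end_near. Qed.

(** Conjugation is the identity near the unit in the chart, so its Jacobian is the identity
    matrix. *)
Lemma Ad1 (k : K) : Ad k = 1%:M.
Proof.
rewrite /Ad; set f := fun u => _; set o := coord _ _.
have fE : \forall u \near o, u = f u.
  have : \forall y \near o, (coord (lg_chart1 K) @` dom (lg_chart1 K)) y.
    apply: open_nbhs_nbhs; split; first exact: coord_open.
    by exists (lg_one K) => //; exact: lg_chart1P.
  apply: filterS => u [x ix <-]; rewrite /f coordK //.
  rewrite (hK k) -lg_mulA.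
  have -> : lg_mul k (lg_inv k) = lg_one K by rewrite hK lg_mulV.
  by rewrite hK lg_mul1.
have df : differentiable f o.
  by apply: near_eq_differentiable fE _; exact: ex_diff.
apply/row_matrixP => r; rewrite !rowE -deriveEjacobian // mulmx1.
by rewrite -(near_eq_derive _ fE) derive_id.
Qed.

Lemma lie_bracket0 X Y : lie_bracket K X Y = 0.
Proof.
rewrite /lie_bracket (_ : (fun u => _) = fun=> Y) ?derive_cst //.
by apply/funext => u; rewrite Ad1 mulmx1.
Qed.

Lemma wedge_bracket0 n (M : manifold R n) k (al : M -> 'M[R]_(n, m)) (omega : lform m M k) x V :
  wedge_bracket K al omega x V = 0.
Proof. by apply: big1 => j _; rewrite lie_bracket0 scaler0. Qed.

End abelian.

(** * Instanton deformations in a chart *)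

(** Evaluates the volume form in [hodge1] on d/dx^k followed by the coordinate vectors other than
    the j-th. The minor is read off from the adjugate of the identity. *)
Lemma det_col_mx_delta (R : comPzRingType) (n : nat) (j k : 'I_n.+1) :
  \det (col_mx (delta_mx 0 k : 'rV[R]_n.+1) (row' j 1%:M : 'M[R]_(n, n.+1)) : 'M[R]_n.+1) =
  (-1) ^+ j *+ (j == k).
Proof.
rewrite (expand_det_row _ 0) (bigD1 k) //= big1 ?addr0; last first.
  move=> l /negPf lk; rewrite mxE; case: splitP => t // _.
  by rewrite ord1 mxE eqxx lk mul0r.
rewrite mxE; case: splitP => t // _; rewrite ord1 mxE !eqxx mul1r /cofactor.
have -> : row' 0 (col' k (col_mx (delta_mx 0 k : 'rV[R]_n.+1)
      (row' j 1%:M : 'M[R]_(n, n.+1)) : 'M[R]_n.+1)) = row' j (col' k 1%:M).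
  apply/matrixP => r s; rewrite !mxE; case: splitP => z; first by rewrite ord1.
  rewrite /= add1n => /eqP; rewrite eqSS => /eqP rz; rewrite !mxE.
  by congr ((lift j _ == _)%:R); exact: val_inj.
have : (\adj (1%:M : 'M[R]_n.+1)) k j = (j == k)%:R.
  have := mul_mx_adj (1%:M : 'M[R]_n.+1); rewrite mul1mx det1 => ->.
  by rewrite mxE eq_sym.
rewrite mxE /cofactor => H.
have -> : \det (row' j (col' k (1%:M : 'M[R]_n.+1))) = (-1) ^+ (j + k) * (j == k)%:R.
  by rewrite -H mulrA -exprD addnn -mul2n exprM sqrrN !expr1n mul1r.
rewrite mulrA -exprD; case: eqP => [<-|_]; rewrite ?mulr0 ?mulr0n // mulr1 mulr1n.
by rewrite add0n addnA exprD addnn -mul2n exprM sqrrN !expr1n mul1r.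
Qed.

Lemma row_mulmx_row (R : pzRingType) m n p q (X : 'M[R]_(m, n)) (Y : 'M[R]_(n, p))
    (Z : 'M[R]_(q, p)) r s : (row r X *m Y *m (row s Z)^T) 0 0 = (X *m Y *m Z^T) r s.
Proof.
rewrite -row_mul mxE [RHS]mxE; apply: eq_bigr => t _.
by rewrite mxE [(row s Z)^T _ _]mxE [row s Z _ _]mxE [Z^T _ _]mxE.
Qed.

Lemma rows_col_mx (R : pzRingType) n (u v : 'rV[R]_n) (V := col_mx u v : 'M[R]_(2, n)) :
  [/\ row ord0 V = u, row' ord0 V = v, row (lift ord0 ord0) V = v & row' (lift ord0 ord0) V = u].
Proof.
by split; apply/matrixP => r s; rewrite !ord1 !mxE; case: splitP => t; rewrite ?ord1.
Qed.

Section chart.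
Variables (R : realType) (gm : clifford_model R) (M : manifold R 6).
Variables (g : metric M) (S : spin_structure gm g) (psi : spinor_field S).
Hypothesis hpsi : nearly_kahler psi.
Variables (m : nat) (K : lie_group R m) (hK : lg_abelian K).
Variables (P : principal_bundle M K) (A : connection P) (eps : ad_one_form P).
Hypothesis heps : infinitesimal_deformation psi A eps.
Variables (i : chart M) (a : sp_idx S) (b : pb_idx P) (c : 'I_m).

Definition dom3 : set M := dom i `&` (sp_dom a `&` pb_dom b).

Definition chart_opens : opens 'rV[R]_6 :=
  Opens (open_coord_image (i := i) (openI (sp_dom_open a) (pb_dom_open b))).
Notation O := chart_opens.
Notation pt := {x : 'rV[R]_6 | oset O x}.

Lemma smooth_chart (W : normedModType R) (D : set M) (f : M -> W) :
  dom3 `<=` D -> smooth_fun D f -> smooth_on (oset O) (f \o par i).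
Proof.
move=> DD /(_ i); apply: smooth_on_sub => _ [x x3 <-]; exists x => //.
by split; [case: x3|exact: DD].
Qed.

Definition ptM (p : pt) : M := par i (sval p).

Lemma ptMP p : dom3 (ptM p).
Proof. by have [x x3 xp] := svalP p; rewrite /ptM -xp coordK //; case: x3. Qed.

Lemma coord_ptM p : coord i (ptM p) = sval p.
Proof. by have [x [ix _] xp] := svalP p; rewrite /ptM -xp coordK. Qed.

(** Opaque on purpose: the lifted coefficients are used only through their values at points. *)
Fact coefs_exist (p q : nat) (D : set M) (f : M -> 'M[R]_(p, q)) :
  dom3 `<=` D -> smooth_fun D f ->
  {X : 'M[smooth_fct O]_(p, q) | forall x : pt, evalmx x X = f (ptM x)}.
Proof.
move=> DD sf; exists (mkmx (smooth_chart DD sf)) => x; exact: evalmx_mkmx.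
Qed.

Let dom3_i : dom3 `<=` dom i. Proof. by move=> x []. Qed.
Let dom3_a : dom3 `<=` sp_dom a. Proof. by move=> x [_ []]. Qed.
Let dom3_ai : dom3 `<=` sp_dom a `&` dom i. Proof. by move=> x [? []]. Qed.
Let dom3_bi : dom3 `<=` pb_dom b `&` dom i. Proof. by move=> x [? []]. Qed.

Definition metA := sval (coefs_exist dom3_i (met_smooth g i)).
Definition frameA := sval (coefs_exist dom3_ai (sp_frame_smooth a i)).
Definition psiA := sval (coefs_exist dom3_a (spf_smooth psi a)).
Definition epsA := sval (coefs_exist dom3_bi (af_smooth eps b i)).
Definition epsA_col : 'cV[smooth_fct O]_6 := col c epsA.

Lemma eval_metA p : evalmx p metA = g i (ptM p).
Proof. by rewrite /metA; case: coefs_exist. Qed.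

Lemma eval_frameA p : evalmx p frameA = sp_frame a i (ptM p).
Proof. by rewrite /frameA; case: coefs_exist. Qed.

Lemma eval_psiA p : evalmx p psiA = psi a (ptM p).
Proof. by rewrite /psiA; case: coefs_exist. Qed.

Lemma eval_epsA p : evalmx p epsA = eps b i (ptM p).
Proof. by rewrite /epsA; case: coefs_exist. Qed.

Lemma eval_epsA_col p : evalmx p epsA_col = col c (eps b i (ptM p)).
Proof. by rewrite /epsA_col /evalmx map_col -/(evalmx _ _) eval_epsA. Qed.

Lemma metA_sym : metA^T = metA.
Proof.
apply: eq_evalmx => p; rewrite evalmx_tr eval_metA.
by apply: met_sym; case: (ptMP p).
Qed.

Lemma frameA_orthonormal : frameA *m metA *m frameA^T = 1%:M.
Proof.
apply: eq_evalmx => p; rewrite !evalmxM evalmx1 evalmx_tr eval_metA eval_frameA.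
by apply: sp_frame_orthonormal; case: (ptMP p) => ? [].
Qed.

Lemma psiA_unit : psiA^T *m psiA = 1%:M.
Proof.
apply: eq_evalmx => p; rewrite !evalmxM evalmx1 evalmx_tr eval_psiA.
apply/matrixP => r s; rewrite !ord1 [RHS]mxE.
by case: hpsi => _ + _; apply; case: (ptMP p) => ? [].
Qed.

Notation half := (constf O 2^-1).
Notation C := (chris (pder O) half metA frameA).

Lemma invmx_met p : invmx (g i (ptM p)) = (sp_frame a i (ptM p))^T *m sp_frame a i (ptM p).
Proof.
have := congr1 (evalmx p) (mulG_EtE frameA_orthonormal).
rewrite !evalmxM evalmx1 evalmx_tr eval_metA eval_frameA => GE.
by rewrite -[LHS]mulmx1 -GE mulKmx //; case: (mulmx1_unit GE).
Qed.

Lemma eval_pder_metA p k s r : evalf p (pder O k (metA s r)) = dmet g i (ptM p) k s r.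
Proof.
rewrite /dmet /pd coord_ptM; apply: evalf_dirder => q.
by have /matrixP/(_ s r) := eval_metA q; rewrite mxE.
Qed.

Lemma eval_chris p k : evalmx p (C k) = \matrix_(r, l) christoffel g i (ptM p) l k r.
Proof.
apply/matrixP => r l; rewrite evalmxE [RHS]mxE /christoffel.
rewrite [X in evalf p X]mxE.
rewrite evalfM evalf_constf evalf_sum; congr (_ * _); apply: eq_bigr => s _.
rewrite evalfM evalfB evalfD !eval_pder_metA; congr (_ * _).
have /matrixP/(_ l s) -> := invmx_met p.
rewrite -evalmxE.
by rewrite evalmxM evalmx_tr eval_frameA.
Qed.

Lemma eval_omega p k q r : evalmx p (omega (pder O) metA frameA C k) q r =
  ip g i (ptM p) (nabla_LC g i (delta_mx 0 k) (fun y => fvec a i y q) (ptM p)) (fvec a i (ptM p) r).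
Proof.
have -> : nabla_LC g i (delta_mx 0 k) (fun y => fvec a i y q) (ptM p) =
    row q (evalmx p (map_mx (pder O k) frameA + frameA *m C k)).
  rewrite evalmxD evalmxM eval_chris raddfD /= /nabla_LC; congr (_ + _).
    rewrite /pd coord_ptM -(@evalmx_dirder _ _ _ _ _ _ (row q frameA)).
      by rewrite map_row /evalmx map_row.
    by move=> x; rewrite /evalmx map_row -/(evalmx _ _) eval_frameA.
  apply/rowP => l; rewrite !mxE (bigD1 k) //= [X in _ + X]big1 ?addr0; last first.
    by move=> s /negPf sk; apply: big1 => t _; rewrite mxE eqxx sk mulr0 mul0r.
  apply: eq_bigr => t _; rewrite [(\matrix_(_, _) _) _ _]mxE [delta_mx _ _ _ _]mxE !eqxx mulr1.
  by rewrite mulrC eval_frameA [fvec _ _ _ _ _ _]mxE.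
rewrite /ip /fvec row_mulmx_row -eval_metA -eval_frameA -evalmx_tr -!evalmxM /omega /theta.
by rewrite !mulmxA.
Qed.

Lemma eval_gammaA p q : evalmx p (gammaA gm O q) = gm q.
Proof. by apply/matrixP => r s; rewrite evalmxE mxE evalf_constf. Qed.

Lemma psiA_killing k : nabS (pder O) half (gammaA gm O) metA frameA C k psiA
  = half *: (gam_dn (gammaA gm O) metA frameA k *m psiA).
Proof.
apply: eq_evalmx => p.
have [ix [ax bx]] := ptMP p.
have [_ _ kil] := hpsi; have := kil a i (ptM p) (delta_mx 0 k) ax ix.
rewrite /nabla_spin /nabS evalmxD evalmxZ !evalmxM eval_psiA => kilE.
have -> : evalmx p (map_mx (pder O k) psiA) = pd i (delta_mx 0 k) (psi a) (ptM p).
  by rewrite /pd coord_ptM; apply: evalmx_dirder => x; rewrite eval_psiA.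
have -> : evalmx p (gam_dn (gammaA gm O) metA frameA k) = cmul a i (ptM p) (delta_mx 0 k).
  rewrite /evalmx map_clif /clif /cmul; apply: eq_bigr => q _.
  congr (_ *: _); last exact: eval_gammaA.
  rewrite /ip /fvec -[delta_mx 0 k]mulmx1 -rowE row_mulmx_row mul1mx.
  by rewrite -eval_metA -eval_frameA -evalmx_tr -evalmxM /evalmx map_row mxE.
rewrite evalf_constf -kilE; congr (_ + _).
rewrite /W /evalmx map_spinW /spinW -scalemxAl; congr (_ *: _).
  by rewrite -[LHS]/(2^-1 * 2^-1) -invfM -natrM.
rewrite /quad mulmx_suml; apply: eq_bigr => q _; rewrite mulmx_suml; apply: eq_bigr => r _.
by rewrite -scalemxAl eval_omega; congr (_ *: (_ *m _ *m _)); exact: eval_gammaA.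
Qed.

Lemma eval_pd_eps (v w : 'rV[R]_6) p : (pd i v (fun y => w *m eps b i y) (ptM p)) 0 c =
  \sum_k \sum_l v 0 k * w 0 l * evalf p (pder O k (epsA_col l 0)).
Proof.
rewrite /pd coord_ptM -(@evalmx_dirder _ _ _ _ _ _ (map_mx (constf O) w *m epsA)); last first.
  move=> x; rewrite evalmxM eval_epsA; congr (_ *m _).
  by apply/matrixP => r s; rewrite evalmxE mxE evalf_constf.
rewrite evalmxE mxE [X in dirder _ X]mxE dirder_sum evalf_sum; apply: eq_bigr => k _.
rewrite evalfM evalf_constf dirder_bigsum evalf_sum mulr_sumr; apply: eq_bigr => l _.
rewrite [map_mx _ _ _ _]mxE dirderM dirder_const mul0r add0r evalfM evalf_constf mulrA.
by rewrite /epsA_col [col _ _ _ _]mxE.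
Qed.

(** With the bracket gone, the exterior derivative on two frame vectors is the antisymmetrised
    matrix of partial derivatives, contracted with the frame on both sides. *)
Lemma epsA_linearised : \sum_(p < 6) \sum_(q < 6 | (p < q)%N)
  (frameA *m (\matrix_(k, l) (pder O k (epsA_col l 0) - pder O l (epsA_col k 0))) *m frameA^T) p q
    *: (gammaA gm O p *m gammaA gm O q *m psiA) = 0.
Proof.
apply: eq_evalmx => x; have [ix [ax bx]] := ptMP x.
have [lin _] := heps; have /matrixP lin0 := lin a b i (ptM x) ax bx ix.
apply/matrixP => r s; rewrite ord1 {s}; have := lin0 r c; rewrite [RHS]mxE => {lin lin0} lin.
rewrite [in RHS]/evalmx map_mx0 [RHS]mxE -[RHS]lin /form2_act.
rewrite evalmxE !summxE evalf_sum; apply: eq_bigr => p _.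
rewrite !summxE evalf_sum; apply: eq_bigr => q _.
rewrite -evalmxE evalmxZ !evalmxM !eval_gammaA eval_psiA [LHS]mxE [RHS]mxE big_ord1.
rewrite mulrC; congr (_ * _).
rewrite /cov_d wedge_bracket0 // addr0 /ext_d !big_ord_recl big_ord0 addr0.
have [-> -> -> ->] := rows_col_mx (fvec a i (ptM x) p) (fvec a i (ptM x) q).
rewrite expr0 expr1 scale1r scaleN1r.
rewrite [RHS]mxE [X in _ = _ + X]mxE !eval_pd_eps.
have fE r' k : fvec a i (ptM x) r' 0 k = evalf x (frameA r' k).
  by rewrite -evalmxE eval_frameA mxE.
rewrite [X in _ = _ - X]exchange_big -sumrB.
under [RHS]eq_bigr do rewrite -sumrB.
rewrite [RHS]exchange_big mxE evalf_sum; apply: eq_bigr => l _.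
rewrite evalfM [(frameA *m _) _ _]mxE evalf_sum mulr_suml; apply: eq_bigr => k _.
by rewrite evalfM [(\matrix_(_, _) _) _ _]mxE evalfB [frameA^T _ _]mxE !fE; ring.
Qed.

(** For an oriented frame [\det theta] is the Riemannian density sqrt(det g), so the gauge condition
    is the required coordinate divergence. *)
Lemma epsA_coclosed :
  \sum_j pder O j
    (\det (theta metA frameA) * (frameA^T *m frameA *m epsA_col) j 0) = 0.
Proof.
have det_theta x : evalf x (\det (theta metA frameA)) = Num.sqrt (\det (g i (ptM x))).
  have [ix [ax _]] := ptMP x.
  have D0 := sp_frame_oriented (a := a) (i := i) ax ix; rewrite -eval_frameA in D0.
  have -> : evalf x (\det (theta metA frameA)) = \det (g i (ptM x) *m (evalmx x frameA)^T).
    by rewrite -det_map_mx -/(evalmx _ _) /theta evalmxM eval_metA evalmx_tr.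
  have := congr1 (fun X => \det (evalmx x X)) frameA_orthonormal.
  rewrite /= !evalmxM evalmx_tr evalmx1 eval_metA det1 !det_mulmx det_tr => H.
  move: (\det (evalmx x frameA)) (\det (g i (ptM x))) D0 H => D Gd D0 H.
  (* Orthonormality reads D Gd D = 1; as D > 0, Gd D is the nonnegative square root of Gd. *)
  have E2 : Gd = (Gd * D) ^+ 2.
    by rewrite -[LHS]mulr1 -H; ring.
  rewrite [X in Num.sqrt X]E2 sqrtr_sqr ger0_norm //.
  by rewrite -(pmulr_rge0 _ D0) mulrA H ler01.
have [_ gf] := heps.
apply: eq_evalf => x; have [ix [ax bx]] := ptMP x.
(* On the coordinate basis, d * eps is the coordinate divergence. *)
have := gf b i (ptM x) 1%:M bx ix; rewrite /cov_d wedge_bracket0 // addr0 /ext_d.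
move=> /rowP/(_ c); rewrite summxE [RHS]mxE => H.
rewrite raddf0 -[RHS]H evalf_sum; apply: eq_bigr => j _.
rewrite row1 /pd coord_ptM.
pose Y : 'rV[smooth_fct O]_m :=
  (constf O ((-1) ^+ j) * \det (theta metA frameA)) *: row j (frameA^T *m frameA *m epsA).
rewrite -(@evalmx_dirder _ _ _ _ _ _ Y); last first.
  move=> y; rewrite /Y evalmxZ evalfM det_theta evalf_constf.
  rewrite /comp -/(ptM y) /hodge1 (bigD1 j) //= big1 ?addr0; last first.
    by move=> k /negPf kj; rewrite det_col_mx_delta eq_sym kj mulr0n mulr0 scale0r.
  rewrite det_col_mx_delta eqxx mulr1n mulrC; congr (_ *: _).
  by rewrite /evalmx map_row -/(evalmx _ _) !evalmxM evalmx_tr eval_frameA eval_epsA invmx_met.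
rewrite [RHS]mxE evalmxE [map_mx _ _ _ _]mxE.
have -> : Y 0 c = constf O ((-1) ^+ j) *
    (\det (theta metA frameA) * (frameA^T *m frameA *m epsA_col) j 0).
  rewrite [LHS]mxE [row _ _ _ _]mxE mulrA; congr (_ * _); rewrite mxE [RHS]mxE.
  by apply: eq_bigr => k _; rewrite [epsA_col _ _]mxE.
(* The sign in [ext_d] cancels the one from the volume form. *)
by rewrite dirderM dirder_const mul0r add0r evalfM evalf_constf mulrA -expr2 sqrr_sign mul1r.
Qed.

Lemma chart_vanishing p0 :
  (forall q : pt, evalf q (nsq frameA epsA_col) <= evalf p0 (nsq frameA epsA_col)) ->
  evalf p0 (nsq frameA epsA_col) <= 0.
Proof.
exact: local_vanishing metA_sym frameA_orthonormal psiA_killing psiA_unit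
  epsA_linearised epsA_coclosed p0.
Qed.
End chart.

(** * The maximum principle on M *)

Section norm_function.
Variables (R : realType) (gm : clifford_model R) (M : manifold R 6).
Variables (g : metric M) (S : spin_structure gm g).
Variables (m : nat) (K : lie_group R m) (hK : lg_abelian K).
Variables (P : principal_bundle M K) (eps : ad_one_form P) (c : 'I_m).

Definition local_normsq (b : pb_idx P) (i : chart M) (x : M) : R :=
  ((col c (eps b i x))^T *m invmx (g i x) *m col c (eps b i x)) 0 0.

Lemma local_normsqE (a : sp_idx S) b i x : sp_dom a x -> dom i x ->
  local_normsq b i x = \sum_p ((sp_frame a i x *m eps b i x) p c) ^+ 2.
Proof.
move=> ax ix; have EgE := sp_frame_orthonormal ax ix.
have gEE : g i x *m ((sp_frame a i x)^T *m sp_frame a i x) = 1%:M by exact: mulG_EtE.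
have gU : g i x \in unitmx by case: (mulmx1_unit gEE).
have -> : local_normsq b i x =
    ((sp_frame a i x *m col c (eps b i x))^T *m (sp_frame a i x *m col c (eps b i x))) 0 0.
  rewrite /local_normsq -[invmx _]mulmx1 -gEE mulKmx // trmx_mul !mulmxA //.
rewrite mxE; apply: eq_bigr => p _.
have -> : (sp_frame a i x *m eps b i x) p c = (sp_frame a i x *m col c (eps b i x)) p 0.
  by rewrite [LHS]mxE [RHS]mxE; apply: eq_bigr => q _; rewrite [col _ _ _ _]mxE.
by rewrite [_^T _ _]mxE expr2.
Qed.

(** Components in one orthonormal frame do not see the chart, and a change of trivialisation acts
    through [Ad], which is trivial. *)
Lemma local_normsq_indep b b' i j x : pb_dom b x -> pb_dom b' x -> dom i x -> dom j x ->
  local_normsq b i x = local_normsq b' j x.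
Proof.
move=> bx b'x ix jx; have [a ax] := sp_dom_cover S x.
rewrite !(local_normsqE _ ax) //; apply: eq_bigr => p _; congr (_ p c ^+ 2).
rewrite (sp_frame_trans ax ix jx) -mulmxA -af_trans //.
by rewrite (af_gauge _ bx b'x) // Ad1 // mulmx1.
Qed.

Definition normsq (x : M) : R :=
  local_normsq (sval (cid (pb_dom_cover P x))) (sval (cid (dom_cover x))) x.

Lemma normsqE b i x : pb_dom b x -> dom i x -> normsq x = local_normsq b i x.
Proof.
move=> bx ix; rewrite /normsq; case: cid => b' /= b'x; case: cid => j /= jx.
exact: local_normsq_indep.
Qed.

Lemma evalf_nsq i (a : sp_idx S) b (p : {y | oset (chart_opens i a b) y}) :
  evalf p (nsq (frameA i a b) (epsA_col eps i a b c)) = normsq (ptM (a := a) (b := b) p).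
Proof.
have [ix [ax bx]] := ptMP p.
rewrite (normsqE bx ix) /local_normsq invmx_met /nsq -evalmxE.
by rewrite -eval_frameA -eval_epsA_col -!evalmx_tr -!evalmxM.
Qed.

Lemma normsq_continuous : continuous normsq.
Proof.
move=> x.
have [i ix] := dom_cover x; have [b bx] := pb_dom_cover P x; have [a ax] := sp_dom_cover S x.
pose w := ext0 (sfun (nsq (frameA i a b) (epsA_col eps i a b c))).
have wE y : dom3 i a b y -> w (coord i y) = normsq y.
  move=> y3; have Oy : oset (chart_opens i a b) (coord i y) by exists y.
  rewrite -[coord i y]/(sval (exist _ (coord i y) Oy)) /w ext0E.
  by rewrite [LHS]evalf_nsq /ptM /= coordK //; case: y3.
have cw : {for coord i x, continuous w}.
  have Ox : oset (chart_opens i a b) (coord i x) by exists x.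
  have D := diff_ext0 (nsq (frameA i a b) (epsA_col eps i a b c)) (exist _ (coord i x) Ox).
  exact: (differentiable_continuous D).
have x3 : dom3 i a b x by [].
rewrite /continuous_at -(wE x x3).
apply: cvg_trans (continuous_comp (coord_continuous ix) cw).
apply: near_eq_cvg; near=> y; rewrite /= wE //.
near: y; apply: open_nbhs_nbhs; split=> //.
by apply: openI; [exact: dom_open|apply: openI; [exact: sp_dom_open|exact: pb_dom_open]].
Unshelve. all: by end_near. Qed.

End norm_function.

Theorem theorem1 (R : realType) (gm : clifford_model R)
  (M : manifold R 6) (hM : compact [set: M])
  (g : metric M) (S : spin_structure gm g) (psi : spinor_field S)
  (hpsi : nearly_kahler psi)
  (m : nat) (K : lie_group R m) (hK : lg_abelian K)
  (P : principal_bundle M K) (A : connection P) (hA : instanton psi A) :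
  rigid psi A.
Proof.
move=> eps heps b i x bx ix.
(* In an orthonormal frame [normsq] is a sum of squares, so being nonpositive makes every frame
   component zero, and the frame is invertible. *)
suff norm0 c y : normsq g eps c y <= 0.
  have [a ax] := sp_dom_cover S x.
  have EeE : sp_frame a i x *m eps b i x = 0.
    apply/matrixP => p c; rewrite [RHS]mxE.
    have := norm0 c x; rewrite (normsqE S hK _ _ bx ix) (local_normsqE _ _ _ ax ix) => le0.
    have /eqP := le_anti (introT andP (conj le0 (sumr_ge0 _ (fun p _ => sqr_ge0 _)))).
    rewrite psumr_eq0; last by move=> q _; exact: sqr_ge0.
    by move=> /allP/(_ p (mem_index_enum _)); rewrite sqrf_eq0 => /eqP.
  have gEE := mulG_EtE (sp_frame_orthonormal ax ix).
  by rewrite -[LHS]mul1mx -gEE -!mulmxA EeE !mulmx0.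
(* A maximum on compact [M] is also one in any chart around it, where the local argument applies. *)
have [x0 _ xmax] := compact_EVT_max (ex_intro _ x I : [set: M] !=set0) hM
  (continuous_subspaceT (normsq_continuous S hK (eps := eps) (c := c))).
rewrite (le_trans (xmax y _)) ?inE //.
have [j jx0] := dom_cover x0; have [b0 bx0] := pb_dom_cover P x0.
have [a ax0] := sp_dom_cover S x0.
have Ox0 : oset (chart_opens j a b0) (coord j x0) by exists x0.
pose p0 : {y | oset (chart_opens j a b0) y} := exist _ (coord j x0) Ox0.
have p0E : ptM (a := a) (b := b0) p0 = x0 by rewrite /ptM /= coordK.
rewrite -p0E -(evalf_nsq hK eps c p0).
apply: (chart_vanishing hpsi hK heps) => q.
by rewrite !evalf_nsq // p0E; apply: xmax; rewrite inE.
Qed.
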